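(* Let $T$ be an additive standard tableau of rectangular shape $a\times b$. The facets $F_R$ of the Kronecker polyhedral cone $PKron_{a,b,ab}$ containing the minimal face $f_T$ are in bijective correspondence with the maximal relaxations $R$ of the tableau $T$.
   Context: Kronecker coefficients: $g(\lambda,\mu,\nu)=\dim([\lambda]\otimes[\mu]\otimes[\nu])^{S_n}$ for partitions of $n$, with $[\lambda]$ the irreducible complex $S_n$-representation indexed by $\lambda$; $g=0$ if the sizes differ. $Kron_{a,b,c}$ is the set of triples of partitions $(\beta,\gamma,\alpha)$ with $\ell(\beta)\le a$, $\ell(\gamma)\le b$, $\ell(\alpha)\le c$ and $g(\beta,\gamma,\alpha)\ne0$, and $PKron_{a,b,c}\subset\mathbb{R}^{a+b+c}$ is the (rational polyhedral) cone generated by it. A facet is a codimension one face. A standard tableau $T$ of shape $a\times b$ is a bijective filling of the boxes $(i,j)$, $1\le i\le a$, $1\le j\le b$, by $1,\dots,ab$, with entries $T(i,j)$ increasing along rows and columns. It is additive if there exist sequences $x_1<\cdots<x_a$ and $y_1<\cdots<y_b$ such that $T(i,j)<T(k,l)\Leftrightarrow x_i+y_j<x_k+y_l$. Put $a_T(\lambda)_i=\sum_{j=1}^b\lambda_{T(i,j)}$, $b_T(\lambda)_j=\sum_{i=1}^a\lambda_{T(i,j)}$, and $f_T=\{(a_T(\lambda),b_T(\lambda),\lambda):\lambda_1\ge\cdots\ge\lambda_{ab}\ge0\}$, which is a face of $PKron_{a,b,ab}$. A relaxation of $T$ is the partition $R$ of the rectangle $a\times b$ into the level sets (regions) of $(i,j)\mapsto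 x_i+y_j$, where $x_1\le\cdots\le x_a$ and $y_1\le\cdots\le y_b$ are real sequences such that $x_i+y_j\le x_k+y_l$ whenever $T(i,j)<T(k,l)$ (each region then consists of boxes numbered by consecutive values of $T$). It is maximal if the vectors $e_k-e_i+f_l-f_j$, for boxes $(i,j)$ and $(k,l)$ in the same region, generate a hyperplane in the weight space; here $e_1,\dots,e_a$, $f_1,\dots,f_b$ are the standard bases of $\mathbb{R}^a$, $\mathbb{R}^b$ and the weight space is the $(a+b-2)$-dimensional space spanned by all the differences $e_k-e_i$ and $f_l-f_j$. The correspondence associates to $R$ the facet $F_R$ defined by the linear function given by the sequences $(x_i),(y_j)$, which is non-negative on all vectors $e_k-e_i+f_l-f_j$ with $T(i,j)<T(k,l)$ (these generate the local cone of $PKron_{a,b,ab}$ around $f_T$, modulo the span of $f_T$).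
   Formalization: The rectangles 1×b and a×1 whose other side is at least 2 are excluded: there the cone PKron equals f_T, so no facet contains f_T, although T has maximal relaxations, and the claim is false. *)

(* Defs.v *)
From HB Require Import structures.
From mathcomp Require Import all_boot all_order all_fingroup all_algebra all_solvable.
From mathcomp Require Import all_field all_character.
From mathcomp Require Import boolp classical_sets functions reals.

Set Implicit Arguments.
Unset Strict Implicit.
Unset Printing Implicit Defensive.

Import Order.TTheory GRing.Theory Num.Theory.

Local Open Scope ring_scope.
Local Open Scope classical_set_scope.

Definition is_partition (s : seq nat) : bool := sorted geq s && (0%N \notin s).

(* The Young diagram of s is filled row by row with 0, ..., n - 1 (where       *)
(* n = sumn s): the entry k lies in row reshape_index s k and column           *)
(* reshape_offset s k.                                                         *)
Definition row_stab (s : seq nat) (n : nat) : {set 'S_n} :=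
  [set p : 'S_n | [forall k, reshape_index s (p k) == reshape_index s k]]%SET.

Definition col_stab (s : seq nat) (n : nat) : {set 'S_n} :=
  [set q : 'S_n | [forall k, reshape_offset s (q k) == reshape_offset s k]]%SET.

(* Coordinates of the Young symmetrizer of s in the basis 'S_n of the group    *)
(* algebra, i.e., in the underlying space of regular_repr.                     *)
Definition young_symmetrizer (s : seq nat) (n : nat) :
    'rV[algC]_#|[set: 'S_n]%G| :=
  \sum_(p in row_stab s n) \sum_(q in col_stab s n)
    (-1) ^+ odd_perm q *: delta_mx 0 (gring_index [set: 'S_n]%G (p * q)%g).

(* The irreducible representation [s] of 'S_n, for s a partition of n: the     *)
(* ideal of the group algebra generated by the Young symmetrizer. It is        *)
(* defined over the rationals, so algC may stand for the complex numbers.      *)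
Definition specht (s : seq nat) (n : nat) :=
  submod_repr
    (cyclic_mx_module (regular_repr algC [set: 'S_n]%G) (young_symmetrizer s n)).

Definition kronecker (s t u : seq nat) : nat :=
  if (sumn t == sumn s) && (sumn u == sumn s) then
    \rank (rfix_mx
      (prod_repr (prod_repr (specht s (sumn s)) (specht t (sumn s)))
                 (specht u (sumn s)))
      [set: 'S_(sumn s)]%SET)
  else 0%N.

Section Cones.
Context {R : realType} {n : nat}.
Implicit Types (S C F : set 'rV[R]_n) (U V : {vspace 'rV[R]_n}).

Definition cone_generated_by S : set 'rV[R]_n :=
  [set v | exists (m : nat) (c : 'I_m -> R) (u : 'I_m -> 'rV[R]_n),
     (forall i, 0 <= c i /\ S (u i)) /\ v = \sum_i c i *: u i].

Definition is_linear_span S U : Prop :=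
  (forall v, S v -> v \in U) /\
  (forall V, (forall v, S v -> v \in V) -> (U <= V)%VS).

Definition is_face C F : Prop :=
  exists l : 'cV[R]_n,
    (forall v, C v -> 0 <= (v *m l) 0 0) /\
    F = [set v | C v /\ (v *m l) 0 0 = 0].

(* The codimension is relative to the linear span of the cone, which need not  *)
(* be the whole space.                                                         *)
Definition is_facet C F : Prop :=
  is_face C F /\
  exists U V, [/\ is_linear_span C U, is_linear_span F V & \dim U = (\dim V).+1].

End Cones.

(* The vector of R^d obtained from a partition of length <= d by appending     *)
(* zeros.                                                                      *)
Definition part_row (R : realType) (d : nat) (s : seq nat) : 'rV[R]_d :=
  \row_i (nth 0%N s i)%:R.

Definition Kron (a b c : nat) (s t u : seq nat) : Prop :=
  [/\ [/\ is_partition s, is_partition t & is_partition u],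
      [/\ (size s <= a)%N, (size t <= b)%N & (size u <= c)%N]
    & kronecker s t u != 0%N].

Definition PKron (R : realType) (a b c : nat) : set 'rV[R]_(a + b + c) :=
  cone_generated_by
    [set v | exists s t u : seq nat, Kron a b c s t u /\
       v = row_mx (row_mx (part_row R a s) (part_row R b t)) (part_row R c u)].

Arguments PKron : clear implicits.

Section Tableaux.
Context {R : realType} {a b : nat}.
Implicit Types (T : 'I_a -> 'I_b -> 'I_(a * b)) (x : 'I_a -> R) (y : 'I_b -> R).
Implicit Types (P : {set {set 'I_a * 'I_b}}).

(* All indices and entries are shifted by one: boxes are (i, j) with i < a and *)
(* j < b, and the entries are 0, ..., ab - 1.                                  *)
Definition standard_tableau T : Prop :=
  [/\ bijective (fun p : 'I_a * 'I_b => T p.1 p.2),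
      (forall (i : 'I_a) (j l : 'I_b), (j < l)%N -> (T i j < T i l)%N)
    & (forall (i k : 'I_a) (j : 'I_b), (i < k)%N -> (T i j < T k j)%N)].

Definition additive_tableau T : Prop :=
  exists x y,
    [/\ (forall i k : 'I_a, (i < k)%N -> x i < x k),
        (forall j l : 'I_b, (j < l)%N -> y j < y l)
      & (forall i j k l, (T i j < T k l)%N <-> x i + y j < x k + y l)].

Definition row_sums T (la : 'rV[R]_(a * b)) : 'rV[R]_a :=
  \row_i \sum_j la 0 (T i j).

Definition col_sums T (la : 'rV[R]_(a * b)) : 'rV[R]_b :=
  \row_j \sum_i la 0 (T i j).

Definition tableau_face T : set 'rV[R]_(a + b + a * b) :=
  [set v | exists la : 'rV[R]_(a * b),
     [/\ (forall s t : 'I_(a * b), (s <= t)%N -> la 0 t <= la 0 s),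
         (forall s, 0 <= la 0 s)
       & v = row_mx (row_mx (row_sums T la) (col_sums T la)) la]].

Definition relaxation_by T x y P : Prop :=
  [/\ (forall i k : 'I_a, (i <= k)%N -> x i <= x k),
      (forall j l : 'I_b, (j <= l)%N -> y j <= y l),
      (forall i j k l, (T i j < T k l)%N -> x i + y j <= x k + y l)
    & P = preim_partition (fun p : 'I_a * 'I_b => x p.1 + y p.2) [set: _]%SET].

Definition basis_e (i : 'I_a) : 'rV[R]_(a + b) := row_mx (delta_mx 0 i) 0.
Definition basis_f (j : 'I_b) : 'rV[R]_(a + b) := row_mx 0 (delta_mx 0 j).

Definition weight_space : {vspace 'rV[R]_(a + b)} :=
  (\sum_(i : 'I_a) \sum_(k : 'I_a) <[basis_e k - basis_e i]> +
   \sum_(j : 'I_b) \sum_(l : 'I_b) <[basis_f l - basis_f j]>)%VS.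

Definition region_weights P : {vspace 'rV[R]_(a + b)} :=
  (\sum_(A in P) \sum_(p in A) \sum_(q in A)
     <[basis_e q.1 - basis_e p.1 + basis_f q.2 - basis_f p.2]>)%VS.

Definition maximal_relaxation T P : Prop :=
  (exists x y, relaxation_by T x y P) /\
  (region_weights P <= weight_space)%VS /\
  \dim weight_space = (\dim (region_weights P)).+1.

(* The linear function on R^a x R^b x R^(ab) which vanishes on tableau_face T  *)
(* and sends (e_k - e_i, f_l - f_j, 0) to x_k - x_i + y_l - y_j. Replacing x,  *)
(* y by x + c, y + d changes it by a function vanishing on PKron a b (a * b),  *)
(* where the three components have the same sum.                               *)
Definition relaxation_form T x y (v : 'rV[R]_(a + b + a * b)) : R :=
  \sum_i x i * lsubmx (lsubmx v) 0 i + \sum_j y j * rsubmx (lsubmx v) 0 j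
  - \sum_i \sum_j (x i + y j) * rsubmx v 0 (T i j).

Definition relaxation_face T x y : set 'rV[R]_(a + b + a * b) :=
  [set v | PKron R a b (a * b) v /\ relaxation_form T x y v = 0].

End Tableaux.

Arguments additive_tableau R {a b} T.
Arguments maximal_relaxation R {a b} T P.
Arguments tableau_face R {a b} T _.

(* Main.v *)
From HB Require Import structures.
From mathcomp Require Import all_fingroup all_solvable all_field all_character.
Require Import Defs.
From mathcomp Require Import all_boot all_order all_algebra.
From mathcomp Require Import boolp classical_sets functions reals.
From mathcomp Require Import zify.

(* Only two facts about Kronecker coefficients are needed. They are obtained   *)
(* by viewing the invariants of [s] (x) [t] (x) [u] as functions on S_n^3.     *)
(*                                                                             *)
(* If g(s, t, u) != 0, then the boxes of u can be labelled by boxes (i, j) of  *)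
(* the rectangle, with row and column contents s and t, injectively on each    *)
(* column of u: a swap of two boxes of a column with the same label would      *)
(* change the sign of an invariant and fix it. In a column of height h, at     *)
(* most min (h, r) labels lie among the r first boxes of T, so an Abel         *)
(* summation shows that (s, t) is (a_T(u), b_T(u)) plus a nonnegative          *)
(* combination of the steps from the box number r of T to the box number r+1.  *)
(*                                                                             *)
(* Conversely each step is realized in the cone, modulo the span of f_T. If    *)
(* the boxes r and r+1 are neither in the same row nor in the same column,     *)
(* exchanging them in T gives another Young diagram with r+1 boxes, and        *)
(* g(mu, mu', 1^(r+1)) != 0. A step from column j to column j+1 is realized by *)
(* the partition u with two columns of heights T(1,j)+1 and T(0,j)+1, after    *)
(* moving one unit from column j to column j+1 in the content b_T(u).          *)
(*                                                                             *)
(* The cone modulo the span of f_T is therefore generated by the steps. The    *)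
(* linear forms that are nonnegative on it are given by the sequences (x), (y) *)
(* weakly compatible with T, and such a form vanishes precisely on the steps   *)
(* inside the regions of the relaxation defined by (x), (y).                   *)

Set Implicit Arguments.
Unset Strict Implicit.
Unset Printing Implicit Defensive.

Import Order.TTheory GRing.Theory Num.Theory.

Local Open Scope ring_scope.

(** * Coordinates of triple tensor products *)

(** A linear form that vanishes on [tableau_face] factors through [to_weight], the projection modulo
    the span of that face. Hence the facets containing the face correspond to the facets of the
    image of the cone, and the core of the proof is that this image is generated by the vectors
    [step_vec r].

    [PKron_weight] shows that no more than the steps is needed: a nonzero invariant labels the boxes
    of the third partition ([kronecker_labelling]), and a count of small labels ([card_below_le])
    makes the coefficients of the steps nonnegative. [step_vec_in] shows that every step occurs,
    through [kronecker_single_column] and [kronecker_two_columns], where an explicit invariant is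
    evaluated as a sum whose nonzero terms all have the same sign. Both directions use the
    dictionary [kronecker_neq0P] between Kronecker coefficients and functions on three copies of the
    symmetric group.

    The rest is linear algebra. The form given by [x] and [y] is nonnegative on the cone exactly
    when [x i + y j] weakly increases with the numbers of [T]. Its zero face contains exactly the
    steps that stay inside a region ([relaxation_form_eq0]), so modulo the kernel it spans
    [region_weights], and codimension one is maximality ([maximal_facet]). Conversely the face knows
    which steps stay inside a region, hence the regions, which are intervals for the numbering of
    [T]; this is injectivity. Surjectivity is [facet_is_relaxation_face]. *)

Section Tprod.
Variable F : fieldType.

Lemma tprod_linearl m1 n1 m2 n2 (B : 'M[F]_(m2, n2)) (k : F)
    (A A' : 'M[F]_(m1, n1)) :
  tprod (k *: A + A') B = k *: tprod A B + tprod A' B.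
Proof.
elim: m1 A A' => [|m1 IH] A A' /=; first by rewrite scaler0 addr0.
have usubE : usubmx ((k *: A + A') : 'M_(1 + m1, n1)) =
  k *: usubmx (A : 'M_(1 + m1, n1)) + usubmx (A' : 'M_(1 + m1, n1)).
  by rewrite linearP.
have dsubE : dsubmx ((k *: A + A') : 'M_(1 + m1, n1)) =
  k *: dsubmx (A : 'M_(1 + m1, n1)) + dsubmx (A' : 'M_(1 + m1, n1)).
  by rewrite linearP.
rewrite usubE dsubE IH -trowbE linearP /= !trowbE.
by rewrite scale_col_mx add_col_mx.
Qed.

Lemma tprod_linearr m1 n1 m2 n2 (A : 'M[F]_(m1, n1)) (k : F)
    (B B' : 'M[F]_(m2, n2)) :
  tprod A (k *: B + B') = k *: tprod A B + tprod A B'.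
Proof.
elim: m1 A => [|m1 IH] A /=; first by rewrite scaler0 addr0.
by rewrite IH linearP /= scale_col_mx add_col_mx.
Qed.

Lemma tprod0l m1 n1 m2 n2 (B : 'M[F]_(m2, n2)) :
  tprod (0 : 'M[F]_(m1, n1)) B = 0.
Proof.
by have := tprod_linearl B (-1) (0 : 'M_(m1, n1)) 0; rewrite scaler0 addr0 scaleN1r addNr.
Qed.

Lemma tprod0r m1 n1 m2 n2 (A : 'M[F]_(m1, n1)) :
  tprod A (0 : 'M[F]_(m2, n2)) = 0.
Proof.
by have := tprod_linearr A (-1) (0 : 'M_(m2, n2)) 0; rewrite scaler0 addr0 scaleN1r addNr.
Qed.

Lemma tprod_suml m1 n1 m2 n2 (B : 'M[F]_(m2, n2)) (I : Type) (r : seq I)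
    (P : pred I) (k : I -> F) (A : I -> 'M[F]_(m1, n1)) :
  tprod (\sum_(i <- r | P i) k i *: A i) B =
  \sum_(i <- r | P i) k i *: tprod (A i) B.
Proof.
elim/big_rec2: _ => [|i x y _ IH]; first exact: tprod0l.
by rewrite tprod_linearl IH.
Qed.

Lemma tprod_sumr m1 n1 m2 n2 (A : 'M[F]_(m1, n1)) (I : Type) (r : seq I)
    (P : pred I) (k : I -> F) (B : I -> 'M[F]_(m2, n2)) :
  tprod A (\sum_(i <- r | P i) k i *: B i) =
  \sum_(i <- r | P i) k i *: tprod A (B i).
Proof.
elim/big_rec2: _ => [|i x y _ IH]; first exact: tprod0r.
by rewrite tprod_linearr IH.
Qed.

(** A tensor is handled as a trilinear form on column vectors, so that matrices acting on [w] move
    to the three arguments and fixing two arguments gives a slice of [w]. *)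
Definition tensor_coord n1 n2 n3 (w : 'rV[F]_(n1 * n2 * n3))
    (x : 'cV[F]_n1) (y : 'cV[F]_n2) (z : 'cV[F]_n3) : F :=
  (w *m (tprod (tprod x y) z : 'M_(_, 1))) 0 0.

Lemma col_sum_delta n (x : 'cV[F]_n) : x = \sum_i x i 0 *: delta_mx i 0.
Proof.
apply/matrixP=> i j; rewrite summxE (bigD1 i) //= !mxE eqxx ord1 eqxx mulr1.
by rewrite big1 ?addr0 // => k /negPf nki; rewrite !mxE eq_sym nki mulr0.
Qed.

Lemma tensor_coord1 n1 n2 n3 (w : 'rV[F]_(n1 * n2 * n3)) x y z :
  tensor_coord w x y z = \sum_i x i 0 * tensor_coord w (delta_mx i 0) y z.
Proof.
rewrite /tensor_coord {1}(col_sum_delta x).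
rewrite !tprod_suml mulmx_sumr summxE; apply: eq_bigr => i _.
by rewrite -scalemxAr mxE.
Qed.

Lemma tensor_coord2 n1 n2 n3 (w : 'rV[F]_(n1 * n2 * n3)) x y z :
  tensor_coord w x y z = \sum_i y i 0 * tensor_coord w x (delta_mx i 0) z.
Proof.
rewrite /tensor_coord {1}(col_sum_delta y).
rewrite tprod_sumr !tprod_suml mulmx_sumr summxE; apply: eq_bigr => i _.
by rewrite -scalemxAr mxE.
Qed.

Lemma tensor_coord3 n1 n2 n3 (w : 'rV[F]_(n1 * n2 * n3)) x y z :
  tensor_coord w x y z = \sum_i z i 0 * tensor_coord w x y (delta_mx i 0).
Proof.
rewrite /tensor_coord {1}(col_sum_delta z).
rewrite !tprod_sumr mulmx_sumr summxE; apply: eq_bigr => i _.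
by rewrite -scalemxAr mxE.
Qed.

(** Each identity factor is a sum of the rank one matrices [D i]; they are summed back one factor at
    a time. *)
Lemma tensor_coord_inj n1 n2 n3 (w w' : 'rV[F]_(n1 * n2 * n3)) :
  (forall i j k, tensor_coord w (delta_mx i 0) (delta_mx j 0) (delta_mx k 0) =
     tensor_coord w' (delta_mx i 0) (delta_mx j 0) (delta_mx k 0)) -> w = w'.
Proof.
have one n : (1%:M : 'M[F]_n) =
  \sum_i 1 *: ((delta_mx i 0 : 'cV_n) *m (delta_mx 0 i : 'rV_n)).
  rewrite mx1_sum_delta; apply: eq_bigr => i _.
  by rewrite scale1r mul_delta_mx.
pose D n (i : 'I_n) : 'M[F]_n := (delta_mx i 0 : 'cV_n) *m (delta_mx 0 i : 'rV_n).
move=> eq_ww'.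
have eq3 i j k : w *m tprod (tprod (D _ i) (D _ j)) (D _ k) =
                 w' *m tprod (tprod (D _ i) (D _ j)) (D _ k).
  rewrite !tprodE !mulmxA; congr (_ *m _); apply/matrixP=> u v.
  by rewrite !ord1; apply: eq_ww'.
have eq2 i j : w *m tprod (tprod (D _ i) (D _ j)) 1%:M =
               w' *m tprod (tprod (D _ i) (D _ j)) 1%:M.
  rewrite (one n3) !tprod_sumr !mulmx_sumr; apply: eq_bigr => k _.
  by rewrite -!scalemxAr eq3.
have eq1 i : w *m tprod (tprod (D _ i) 1%:M) 1%:M =
             w' *m tprod (tprod (D _ i) 1%:M) 1%:M.
  rewrite (one n2) !tprod_sumr !tprod_suml !mulmx_sumr; apply: eq_bigr => k _.
  by rewrite -!scalemxAr eq2.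
rewrite -[w]mulmx1 -[w']mulmx1 -!tprod1 (one n1).
rewrite !tprod_suml !mulmx_sumr; apply: eq_bigr => i _.
by rewrite -!scalemxAr eq1.
Qed.

Lemma tensor_coord_mul n1 n2 n3 m1 m2 m3 (w : 'rV[F]_(n1 * n2 * n3))
    (A : 'M_(n1, m1)) (B : 'M_(n2, m2)) (C : 'M_(n3, m3)) x y z :
  tensor_coord (w *m tprod (tprod A B) C) x y z =
  tensor_coord w (A *m x) (B *m y) (C *m z).
Proof. by rewrite /tensor_coord !tprodE mulmxA. Qed.

Lemma tensor_of_coord n1 n2 n3 (f : 'I_n1 -> 'I_n2 -> 'I_n3 -> F) :
  exists w : 'rV[F]_(n1 * n2 * n3), forall i j k,
    tensor_coord w (delta_mx i 0) (delta_mx j 0) (delta_mx k 0) = f i j k.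
Proof.
pose e i j k : 'rV[F]_(n1 * n2 * n3) :=
  (tprod (tprod (delta_mx 0 i : 'rV_n1) (delta_mx 0 j : 'rV_n2))
    (delta_mx 0 k : 'rV_n3) : 'M_(1, _)).
exists (\sum_i \sum_j \sum_k f i j k *: e i j k) => i j k.
have dd n (i1 i2 : 'I_n) : (delta_mx 0 i1 : 'rV[F]_n) *m (delta_mx i2 0 : 'cV_n) =
    (i1 == i2)%:R *: 1%:M.
  by rewrite mul_delta_mx_cond scaler_nat; congr (_ *+ _); apply/matrixP=> u v;
     rewrite !ord1 !mxE.
have eE i1 j1 k1 : tensor_coord (e i1 j1 k1) (delta_mx i 0) (delta_mx j 0)
    (delta_mx k 0) = ((i1 == i) && (j1 == j) && (k1 == k))%:R.
  have E : tensor_coord (e i1 j1 k1) (delta_mx i 0) (delta_mx j 0) (delta_mx k 0) =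
      (tprod (tprod ((i1 == i)%:R *: (1%:M : 'M[F]_1)) ((j1 == j)%:R *: (1%:M : 'M[F]_1)))
         ((k1 == k)%:R *: (1%:M : 'M[F]_1)) : 'M_1) 0 0.
    rewrite -!dd tprodE.
    by have := tprodE (tprod (delta_mx 0 i1 : 'rV[F]_n1) (delta_mx 0 j1 : 'rV_n2))
      (tprod (delta_mx i 0 : 'cV_n1) (delta_mx j 0 : 'cV_n2))
      (delta_mx 0 k1 : 'rV_n3) (delta_mx k 0 : 'cV_n3) => ->.
  rewrite {}E.
  have := tprod_linearl (1%:M : 'M[F]_1) (i1 == i)%:R (1%:M : 'M[F]_1) 0.
  rewrite !addr0 tprod0l addr0 => E1.
  have E2 := tprod_linearr (1%:M : 'M[F]_1) (j1 == j)%:R (1%:M : 'M[F]_1) 0.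
  move: E2; rewrite !addr0 tprod0r addr0 => E2.
  have := tprod_linearr ((i1 == i)%:R *: (1%:M : 'M[F]_1)) (j1 == j)%:R (1%:M : 'M[F]_1) 0.
  rewrite !addr0 tprod0r addr0 => ->; rewrite E1 scalerA.
  have := tprod_linearr (((j1 == j)%:R * (i1 == i)%:R : F) *:
    tprod (1%:M : 'M[F]_1) (1%:M : 'M[F]_1)) (k1 == k)%:R (1%:M : 'M[F]_1) 0.
  rewrite !addr0 tprod0r addr0 => ->.
  have := tprod_linearl (1%:M : 'M[F]_1) ((j1 == j)%:R * (i1 == i)%:R)
    (tprod (1%:M : 'M[F]_1) (1%:M : 'M[F]_1)) 0.
  rewrite !addr0 tprod0l addr0 => ->.
  rewrite !tprod1 !mxE /= mulr1.
  by case: (i1 == i); case: (j1 == j); case: (k1 == k); rewrite ?mulr1 ?mulr0.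
rewrite /tensor_coord mulmx_suml summxE (bigD1 i) //= [X in _ + X]big1 => [|i1 ni].
  rewrite mulmx_suml summxE (bigD1 j) //= [X in _ + X + _]big1 => [|j1 nj].
    rewrite mulmx_suml summxE (bigD1 k) //= [X in _ + X + _ + _]big1 => [|k1 nk].
      rewrite -scalemxAl mxE.
      have := eE i j k; rewrite /tensor_coord => ->.
      by rewrite !eqxx mulr1 !addr0.
    rewrite -scalemxAl mxE; have := eE i j k1; rewrite /tensor_coord => ->.
    by rewrite (negPf nk) andbF mulr0.
  rewrite mulmx_suml summxE big1 // => k1 _.
  rewrite -scalemxAl mxE; have := eE i j1 k1; rewrite /tensor_coord => ->.
  by rewrite (negPf nj) andbF mulr0.
rewrite mulmx_suml summxE big1 // => j1 _.
rewrite mulmx_suml summxE big1 // => k1 _.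
rewrite -scalemxAl mxE; have := eE i1 j1 k1; rewrite /tensor_coord => ->.
by rewrite (negPf ni) mulr0.
Qed.

End Tprod.

(** * Specht modules as spaces of functions on the symmetric group *)

Section Stab.
Variables (n : nat) (K : eqType).
Implicit Types (f : 'I_n -> K) (p q : 'S_n).

Definition fiber_stab f : {set 'S_n} := [set p : 'S_n | [forall k, f (p k) == f k]]%SET.

Lemma fiber_stabP f p : reflect (forall k, f (p k) = f k) (p \in fiber_stab f).
Proof. by rewrite inE; apply: (iffP forallP) => H k; apply/eqP/H. Qed.

Lemma fiber_stab1 f : (1%g : 'S_n) \in fiber_stab f.
Proof. by apply/fiber_stabP=> k; rewrite perm1. Qed.

Lemma fiber_stabM f p q : p \in fiber_stab f -> q \in fiber_stab f ->
  (p * q)%g \in fiber_stab f.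
Proof.
by move=> /fiber_stabP Hp /fiber_stabP Hq; apply/fiber_stabP=> k; rewrite permM Hq.
Qed.

Lemma fiber_stabV f p : (p^-1%g \in fiber_stab f) = (p \in fiber_stab f).
Proof.
have V r : r \in fiber_stab f -> r^-1%g \in fiber_stab f.
  by move=> /fiber_stabP Hr; apply/fiber_stabP=> k; rewrite -(Hr (r^-1 k)%g) permKV.
by apply/idP/idP => [/V|]; rewrite ?invgK //; apply: V.
Qed.

Lemma fiber_stabMl f p q : p \in fiber_stab f ->
  ((p * q)%g \in fiber_stab f) = (q \in fiber_stab f).
Proof.
move=> fp; apply/idP/idP => [fpq|]; last exact: fiber_stabM.
by rewrite -(mulKg p q) fiber_stabM ?fiber_stabV.
Qed.

Lemma fiber_stabMr f p q : q \in fiber_stab f ->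
  ((p * q)%g \in fiber_stab f) = (p \in fiber_stab f).
Proof.
move=> fq; apply/idP/idP => [fpq|fp]; last exact: fiber_stabM.
by rewrite -(mulgK q p) fiber_stabM ?fiber_stabV.
Qed.

End Stab.

Section Specht.
Variables (s : seq nat) (n : nat).
Implicit Types (f y h : 'S_n -> algC) (p q g : 'S_n).

Definition row_of (k : 'I_n) : nat := reshape_index s k.
Definition col_of (k : 'I_n) : nat := reshape_offset s k.

Lemma row_stabE : row_stab s n = fiber_stab row_of. Proof. by []. Qed.
Lemma col_stabE : col_stab s n = fiber_stab col_of. Proof. by []. Qed.

Definition rowsym f g : algC := \sum_(p in row_stab s n) f (p * g)%g.
Definition colsym f g : algC :=
  \sum_(q in col_stab s n) (-1) ^+ odd_perm q * f (q * g)%g.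

(* rowsym (colsym y) is the product of young_symmetrizer s n and y.            *)
Definition in_specht f : Prop := exists y, f =1 rowsym (colsym y).

Lemma rowsym_ext f1 f2 : f1 =1 f2 -> rowsym f1 =1 rowsym f2.
Proof. by move=> E g; apply: eq_bigr => p _; rewrite E. Qed.

Lemma rowsym_inv f p g : p \in row_stab s n -> rowsym f (p * g)%g = rowsym f g.
Proof.
move=> Rp; rewrite /rowsym [RHS](reindex_inj (mulIg p)) /=.
by apply: eq_big => [r|r _]; rewrite ?mulgA // row_stabE fiber_stabMr.
Qed.

Lemma colsym_anti f q g : q \in col_stab s n ->
  colsym f (q * g)%g = (-1) ^+ odd_perm q * colsym f g.
Proof.
move=> Cq; rewrite /colsym [in RHS](reindex_inj (mulIg q)) /= mulr_sumr.
apply: eq_big => [r|r _]; first by rewrite col_stabE fiber_stabMr.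
rewrite odd_permM signr_addb -!mulgA.
by case: (odd_perm r); case: (odd_perm q); rewrite ?(mulN1r, mul1r, mulr1, mulrN, opprK).
Qed.

Lemma rowsym_id f : (forall p g, p \in row_stab s n -> f (p * g)%g = f g) ->
  rowsym f =1 fun g => #|row_stab s n|%:R * f g.
Proof.
move=> invf g; rewrite /rowsym (eq_bigr (fun=> f g)) => [|p Rp]; last exact: invf.
by rewrite sumr_const mulr_natl.
Qed.

Lemma colsym_id f :
  (forall q g, q \in col_stab s n -> f (q * g)%g = (-1) ^+ odd_perm q * f g) ->
  colsym f =1 fun g => #|col_stab s n|%:R * f g.
Proof.
move=> invf g; rewrite /colsym (eq_bigr (fun=> f g)) => [|p Rp].
  by rewrite sumr_const mulr_natl.
by rewrite invf // signrMK.
Qed.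

(** The symmetrizers [rowsym] and [colsym] are self-adjoint for this positive definite Hermitian
    form, which yields the two vanishing criteria below. *)
Definition dot f h : algC := \sum_g f g * (h g)^*.

Lemma dot_eq0 f : dot f f = 0 -> f =1 fun=> 0.
Proof.
move=> ff0 g; apply/eqP; rewrite -mul_conjC_eq0.
have: [forall g, f g * (f g)^* == 0].
  apply/forallP=> g'; have := ff0; rewrite /dot => /eqP.
  by rewrite psumr_eq0 => [/allP /(_ g' (mem_index_enum _))|? _]; rewrite ?mul_conjC_ge0.
by move/forallP.
Qed.

Lemma rowsym_adj f h : dot (rowsym f) h = dot f (rowsym h).
Proof.
rewrite /dot /rowsym; under eq_bigr do rewrite mulr_suml.
under [RHS]eq_bigr do rewrite rmorph_sum mulr_sumr.
rewrite exchange_big [RHS]exchange_big /= (reindex_inj invg_inj) /=.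
apply: eq_big => [p|p _]; first by rewrite row_stabE fiber_stabV.
by rewrite (reindex_inj (mulgI p)); apply: eq_bigr => g _; rewrite mulKg.
Qed.

Lemma colsym_adj f h : dot (colsym f) h = dot f (colsym h).
Proof.
rewrite /dot /colsym; under eq_bigr do rewrite mulr_suml.
under [RHS]eq_bigr do rewrite rmorph_sum mulr_sumr.
rewrite exchange_big [RHS]exchange_big /= (reindex_inj invg_inj) /=.
apply: eq_big => [p|p _]; first by rewrite col_stabE fiber_stabV.
rewrite (reindex_inj (mulgI p)); apply: eq_bigr => g _.
by rewrite mulKg odd_permV rmorphM /= rmorph_sign -mulrA mulrCA.
Qed.

Lemma in_specht_row f p g : in_specht f -> p \in row_stab s n -> f (p * g)%g = f g.
Proof. by case=> y fE Rp; rewrite !fE rowsym_inv. Qed.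

Lemma card_row_neq0 : #|row_stab s n|%:R != 0 :> algC.
Proof.
by rewrite pnatr_eq0 -lt0n; apply/card_gt0P; exists 1%g; rewrite row_stabE fiber_stab1.
Qed.

Lemma card_col_neq0 : #|col_stab s n|%:R != 0 :> algC.
Proof.
by rewrite pnatr_eq0 -lt0n; apply/card_gt0P; exists 1%g; rewrite col_stabE fiber_stab1.
Qed.

Lemma dot_extl f f' h : f =1 f' -> dot f h = dot f' h.
Proof. by move=> E; apply: eq_bigr => g _; rewrite E. Qed.

Lemma dot_extr f h h' : h =1 h' -> dot f h = dot f h'.
Proof. by move=> E; apply: eq_bigr => g _; rewrite E. Qed.

Lemma dot_natl m f h : dot (fun g => m%:R * f g) h = m%:R * dot f h.
Proof. by rewrite /dot mulr_sumr; apply: eq_bigr => g _; rewrite mulrA. Qed.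

Lemma dot_natr m f h : dot f (fun g => m%:R * h g) = m%:R * dot f h.
Proof.
by rewrite /dot mulr_sumr; apply: eq_bigr => g _; rewrite rmorphM rmorph_nat mulrCA.
Qed.

Lemma dot0l f h : f =1 (fun=> 0) -> dot f h = 0.
Proof. by move=> f0; rewrite /dot big1 // => g _; rewrite f0 mul0r. Qed.

Lemma dot0r f h : h =1 (fun=> 0) -> dot f h = 0.
Proof. by move=> f0; rewrite /dot big1 // => g _; rewrite f0 conjC0 mulr0. Qed.

(* By adjunction <a b y, f> = <y, b a f>, and a f = #|R| f since f is in a b A. *)
Lemma specht_colsym_eq0 f : in_specht f -> colsym f =1 (fun=> 0) -> f =1 fun=> 0.
Proof.
move=> Sf bf0; apply: dot_eq0; have [y fE] := Sf.
rewrite (dot_extl _ fE) rowsym_adj.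
rewrite (dot_extr _ (rowsym_id (fun p g => in_specht_row g Sf))) dot_natr.
by rewrite colsym_adj dot0r ?mulr0.
Qed.

(* <b f, b f> and <a b f, f> are both positive multiples of <b f, f>.          *)
Lemma rowsym_colsym_eq0 f : (forall p g, p \in row_stab s n -> f (p * g)%g = f g) ->
  rowsym (colsym f) =1 (fun=> 0) -> colsym f =1 fun=> 0.
Proof.
move=> invf abf0; apply: dot_eq0.
rewrite -colsym_adj (dot_extl _ (colsym_id (fun q g => colsym_anti f g (q := q)))).
rewrite dot_natl; have : dot (rowsym (colsym f)) f = 0 by rewrite dot0l.
rewrite rowsym_adj (dot_extr _ (rowsym_id invf)) dot_natr => /eqP.
by rewrite mulf_eq0 (negPf card_row_neq0) /= => /eqP->; rewrite mulr0.
Qed.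

Lemma in_specht_ext f f' : f =1 f' -> in_specht f -> in_specht f'.
Proof. by move=> E [y fE]; exists y => g; rewrite -E. Qed.

Lemma in_specht_sum (I : Type) (r : seq I) (P : pred I) (c : I -> algC)
    (F : I -> 'S_n -> algC) :
  (forall i, P i -> in_specht (F i)) ->
  in_specht (fun g => \sum_(i <- r | P i) c i * F i g).
Proof.
move=> SF.
have addS f f' k : in_specht f -> in_specht f' -> in_specht (fun g => k * f g + f' g).
  move=> [y fE] [y' f'E]; exists (fun g => k * y g + y' g) => g; rewrite fE f'E.
  rewrite /rowsym mulr_sumr -big_split; apply: eq_bigr => p _ /=.
  rewrite /colsym mulr_sumr -big_split; apply: eq_bigr => q _ /=.
  by rewrite mulrDr mulrCA.
elim: r => [|i r IH].
  exists (fun=> 0) => g; rewrite big_nil /rowsym big1 // => p _.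
  by rewrite /colsym big1 // => q _; rewrite mulr0.
case Pi: (P i); last by apply: in_specht_ext IH => g; rewrite big_cons Pi.
apply: in_specht_ext (addS _ _ (c i) (SF _ Pi) IH) => g.
by rewrite big_cons Pi.
Qed.

End Specht.

(** * Kronecker coefficients and invariant functions *)

Section Bridge.
Variable n : nat.
Local Notation G := [set: 'S_n]%G.
Local Notation rG := (regular_repr algC G).
Local Notation idx := (gring_index G).

Lemma idxK (g : 'S_n) : enum_val (idx g) = g.
Proof. by rewrite gring_indexK ?inE. Qed.

Lemma delta_regular (g h : 'S_n) :
  delta_mx 0 (idx g) *m rG h = delta_mx 0 (idx (g * h)%g) :> 'rV_#|G|.
Proof. by rewrite -rowE rowK idxK. Qed.

Lemma idx_eq (g h : 'S_n) : (idx g == idx h) = (g == h).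
Proof. exact: inj_eq (can_inj idxK) _ _. Qed.

Lemma regular_delta (g h : 'S_n) :
  rG h *m delta_mx (idx g) 0 = delta_mx (idx (g * h^-1)%g) 0 :> 'cV_#|G|.
Proof.
apply/matrixP=> i j; rewrite ord1 -colE !mxE /= eqxx ?andbT /=.
rewrite -{2}(gring_valK i) !idx_eq; congr (_%:R); congr nat_of_bool.
by apply/eqP/eqP => [->|->]; rewrite ?mulgK ?mulgKV.
Qed.

Lemma young_coord s (y : 'S_n -> algC) g :
  (young_symmetrizer s n *m (\sum_(h in G) y h *: rG h)) 0 (idx g) =
  rowsym s (colsym s y) g.
Proof.
rewrite /young_symmetrizer mulmx_suml summxE.
rewrite /rowsym [RHS](reindex_inj invg_inj) /=.
apply: eq_big => [p|p Rp]; first by rewrite row_stabE fiber_stabV.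
rewrite mulmx_suml summxE /colsym [RHS](reindex_inj invg_inj) /=.
apply: eq_big => [q|q Cq]; first by rewrite col_stabE fiber_stabV.
rewrite -scalemxAl mxE odd_permV; congr (_ * _).
rewrite mulmx_sumr summxE (bigD1 (q^-1 * (p^-1 * g))%g) ?inE //= big1 => [|h /andP[_ nh]].
  by rewrite -scalemxAr delta_regular !mxE !idx_eq !mulgA mulgK mulgV mul1g !eqxx mulr1 addr0.
rewrite -scalemxAr delta_regular !mxE !idx_eq /=.
case: eqP => [E|]; last by rewrite mulr0.
by case/eqP: nh; rewrite E !mulgA mulgKV mulVg mul1g.
Qed.

Lemma in_spechtP s (x : 'rV[algC]_#|G|) :
  (x <= cyclic_mx rG (young_symmetrizer s n))%MS <-> in_specht s (fun g => x 0 (idx g)).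
Proof.
split=> [/cyclic_mxP[A /envelop_mxP[y ->] ->]|[y xE]].
  by exists y => g; rewrite young_coord.
apply/cyclic_mxP; exists (\sum_(h in G) y h *: rG h).
  by apply/envelop_mxP; exists y.
apply/rowP=> i; rewrite -(gring_valK i).
by rewrite xE young_coord.
Qed.

Local Notation U s := (cyclic_mx rG (young_symmetrizer s n)).
Local Notation val1 s := (val_submod (1%:M : 'M[algC]_(\rank (U s)))).
Local Notation proj1 s := (in_submod (U s) (1%:M : 'M[algC]_#|G|)).
Local Notation e g := (delta_mx (idx g) 0 : 'cV[algC]_#|G|).

(** The invariants of the triple tensor product, seen inside the functions on three copies of the
    group; the group acts by simultaneous right translation. *)
Definition kron_invariant s t u (F : 'S_n -> 'S_n -> 'S_n -> algC) : Prop :=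
  [/\ forall g2 g3, in_specht s (fun g => F g g2 g3),
      forall g1 g3, in_specht t (fun g => F g1 g g3),
      forall g1 g2, in_specht u (fun g => F g1 g2 g)
    & forall h g1 g2 g3, F (g1 * h)%g (g2 * h)%g (g3 * h)%g = F g1 g2 g3].

Lemma specht_val s g : val1 s *m rG g = specht s n g *m val1 s.
Proof. by rewrite -val_submodE -[specht s n g]mul1mx val_submodJ ?inE. Qed.

Lemma specht_proj s g : specht s n g = val1 s *m rG g *m proj1 s.
Proof. by rewrite -in_submodE. Qed.

Lemma val_proj s : val1 s *m proj1 s = 1%:M.
Proof. by rewrite -in_submodE val_submodK. Qed.

Lemma proj_val s (x : 'rV_#|G|) : (x <= U s)%MS -> x *m (proj1 s *m val1 s) = x.
Proof. by move=> Ux; rewrite mulmxA -in_submodE -val_submodE in_submodK. Qed.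

Lemma mul_delta_coord m (A : 'M[algC]_(m, #|G|)) g k : (A *m e g) k 0 = A k (idx g).
Proof. by rewrite -colE mxE. Qed.

Lemma slice_in_specht s (f : 'S_n -> algC) (y : 'I_(\rank (U s)) -> algC) :
  (forall g, f g = \sum_k (val1 s *m e g) k 0 * y k) -> in_specht s f.
Proof.
move=> fE; apply: (in_specht_ext (f := fun g => ((\row_k y k) *m val1 s) 0 (idx g))).
  move=> g; rewrite fE mxE; apply: eq_bigr => k _.
  by rewrite mul_delta_coord mxE mulrC.
by apply/in_spechtP; rewrite -val_submodE val_submodP.
Qed.

(** The matrix [proj1 s *m val1 s] is a projection onto the Specht ideal, so it does not change a
    linear form whose coordinates lie in that ideal. *)
Lemma proj_slice s (f : 'S_n -> algC) (y : 'cV[algC]_#|G| -> algC) g :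
  in_specht s f -> (forall x, y x = \sum_k x k 0 * f (enum_val k)) ->
  y (proj1 s *m val1 s *m e g) = f g.
Proof.
move=> Sf yE; pose x : 'rV_#|G| := \row_k f (enum_val k).
have Ux : (x <= U s)%MS.
  by apply/in_spechtP; apply: in_specht_ext Sf => h; rewrite mxE idxK.
have := congr1 (fun z : 'rV__ => z 0 (idx g)) (proj_val Ux).
rewrite yE !mxE idxK => <-; apply: eq_bigr => k _.
by rewrite mul_delta_coord !mxE mulrC.
Qed.

Lemma rfix_specht_neq0 s t u :
  \rank (rfix_mx (prod_repr (prod_repr (specht s n) (specht t n)) (specht u n)) G)
    != 0%N <->
  exists F, kron_invariant s t u F /\ exists g1 g2 g3, F g1 g2 g3 != 0.
Proof.
set rho := prod_repr _ _.
have rhoE h : rho h = tprod (tprod (specht s n h) (specht t n h)) (specht u n h) by [].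
split=> [|[F [[Fs Ft Fu Finv] [g1 [g2 [g3 nzF]]]]]].
  rewrite mxrank_eq0 => /rowV0Pn[w /rfix_mxP fixw nzw].
  pose w' := w *m tprod (tprod (val1 s) (val1 t)) (val1 u).
  have fixw' h : w' *m tprod (tprod (rG h) (rG h)) (rG h) = w'.
    have valJ : tprod (tprod (val1 s) (val1 t)) (val1 u) *m
        tprod (tprod (rG h) (rG h)) (rG h) =
        rho h *m tprod (tprod (val1 s) (val1 t)) (val1 u).
      by rewrite rhoE -!tprodE !specht_val.
    by rewrite /w' -mulmxA valJ mulmxA fixw ?inE.
  pose F g1 g2 g3 := tensor_coord w' (e g1) (e g2) (e g3).
  exists F; split; last first.
    apply: contrapT => F0; case/eqP: nzw.
    have w'0 : w' = 0.
      apply: tensor_coord_inj => i j k; rewrite -(gring_valK i) -(gring_valK j) -(gring_valK k).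
      rewrite {2}/tensor_coord mul0mx mxE; apply/eqP; apply/negPn/negP => nz.
      by apply: F0; exists (enum_val i), (enum_val j), (enum_val k).
    have valK : tprod (tprod (val1 s) (val1 t)) (val1 u) *m
        tprod (tprod (proj1 s) (proj1 t)) (proj1 u) = 1%:M.
      by rewrite -!tprodE !val_proj !tprod1.
    by rewrite -[w]mulmx1 -valK mulmxA -/w' w'0 mul0mx.
  split.
  - move=> g2 g3; apply: slice_in_specht => g.
    by rewrite /F /w' tensor_coord_mul tensor_coord1.
  - move=> g1 g3; apply: slice_in_specht => g.
    by rewrite /F /w' tensor_coord_mul tensor_coord2.
  - move=> g1 g2; apply: slice_in_specht => g.
    by rewrite /F /w' tensor_coord_mul tensor_coord3.
  - move=> h g1 g2 g3; rewrite /F -{2}(fixw' h^-1%g) tensor_coord_mul.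
    by rewrite !regular_delta invgK.
have [w' w'E] := tensor_of_coord
  (fun i j k : 'I_#|G| => F (enum_val i) (enum_val j) (enum_val k)).
have w'F h1 h2 h3 : tensor_coord w' (e h1) (e h2) (e h3) = F h1 h2 h3.
  by rewrite w'E !idxK.
pose Q v := proj1 v *m val1 v.
have w'Q : w' *m tprod (tprod (Q s) (Q t)) (Q u) = w'.
  apply: tensor_coord_inj => i j k.
  rewrite -(gring_valK i) -(gring_valK j) -(gring_valK k).
  move: (enum_val i) (enum_val j) (enum_val k) => h1 h2 h3 {i j k}.
  rewrite tensor_coord_mul w'F.
  have E1 i j : tensor_coord w' (Q s *m e h1) (delta_mx i 0) (delta_mx j 0) =
      F h1 (enum_val i) (enum_val j).
    apply: (proj_slice (f := fun h => F h (enum_val i) (enum_val j))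
      (y := fun x => tensor_coord w' x _ _)) => // x.
    by rewrite tensor_coord1; apply: eq_bigr => k _; rewrite w'E.
  have E2 i : tensor_coord w' (Q s *m e h1) (Q t *m e h2) (delta_mx i 0) =
      F h1 h2 (enum_val i).
    apply: (proj_slice (f := fun h => F h1 h (enum_val i))
      (y := fun x => tensor_coord w' _ x _)) => // x.
    by rewrite tensor_coord2; apply: eq_bigr => k _; rewrite E1.
  apply: (proj_slice (f := fun h => F h1 h2 h)
    (y := fun x => tensor_coord w' _ _ x)) => // x.
  by rewrite tensor_coord3; apply: eq_bigr => k _; rewrite E2.
have fixw' h : w' *m tprod (tprod (rG h) (rG h)) (rG h) = w'.
  apply: tensor_coord_inj => i j k.
  rewrite -(gring_valK i) -(gring_valK j) -(gring_valK k).
  by rewrite tensor_coord_mul !regular_delta !w'F Finv.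
pose w := w' *m tprod (tprod (proj1 s) (proj1 t)) (proj1 u).
have wE : w *m tprod (tprod (val1 s) (val1 t)) (val1 u) = w'.
  by rewrite /w -mulmxA -!tprodE.
rewrite mxrank_eq0; apply/rowV0Pn; exists w; last first.
  apply: contraNneq nzF => w0; rewrite -w'F -wE w0 mul0mx.
  by rewrite /tensor_coord mul0mx mxE.
apply/rfix_mxP => h _.
have rhoP : rho h = tprod (tprod (val1 s) (val1 t)) (val1 u) *m
    (tprod (tprod (rG h) (rG h)) (rG h) *m tprod (tprod (proj1 s) (proj1 t)) (proj1 u)).
  by rewrite rhoE !specht_proj -!tprodE -!mulmxA.
by rewrite rhoP (mulmxA w) wE (mulmxA w') fixw'.
Qed.

Lemma kronecker_neq0P s t u : sumn s = n -> sumn t = n -> sumn u = n ->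
  kronecker s t u != 0%N <->
  exists F, kron_invariant s t u F /\ exists g1 g2 g3, F g1 g2 g3 != 0.
Proof.
move=> sn tn un; rewrite -rfix_specht_neq0 /kronecker tn un sn !eqxx /=.
by case: n / sn tn un.
Qed.

End Bridge.

(** * Labellings of the elements of a tableau *)

Section ColumnLabels.
Variables (n : nat) (cls : 'I_n -> nat).
Implicit Types (l lab : 'I_n -> nat) (e : 'I_n).

Definition injective_on_classes l : Prop :=
  forall e e', cls e = cls e' -> l e = l e' -> e = e'.

Definition down_closed l : Prop :=
  forall e i, (i < l e)%N -> exists e', cls e' = cls e /\ l e' = i.

Definition rank_in_class l e : nat :=
  #|[set e' | (cls e' == cls e) && (l e' < l e)%N]|.

Lemma rank_in_class_le l e : injective_on_classes l -> (rank_in_class l e <= l e)%N.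
Proof.
move=> injl; rewrite -[leqRHS]card_ord /rank_in_class.
case: (posnP (l e)) => [l0|lpos].
  by rewrite l0 card_ord eq_leq //; apply: eq_card0 => e'; rewrite !inE ltn0 andbF.
pose h e' : 'I_(l e) := Ordinal (ltn_pmod (l e') lpos).
rewrite -(card_in_imset (f := h)) ?max_card // => e1 e2.
rewrite !inE => /andP[/eqP c1 l1] /andP[/eqP c2 l2] /(congr1 val) /=.
by rewrite !modn_small // => /injl; apply; rewrite c1 c2.
Qed.

Lemma rank_in_class_ge l e : down_closed l -> (l e <= rank_in_class l e)%N.
Proof.
move=> downl; rewrite -[leqLHS]card_ord /rank_in_class.
have /choice[h hE] : forall i : 'I_(l e), exists e', cls e' = cls e /\ l e' = i.
  by move=> i; apply: downl.
have inj_h : injective h.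
  move=> i j eq_h; apply: val_inj => /=.
  by have [_ <-] := hE i; have [_ <-] := hE j; rewrite eq_h.
rewrite -(card_codom inj_h); apply/subset_leq_card/fintype.subsetP => _ /codomP[i ->].
by rewrite inE; have [-> ->] := hE i; rewrite eqxx ltn_ord.
Qed.

(* Each pair of distinct elements of a class is counted exactly once on the    *)
(* left, whatever the labelling.                                               *)
Lemma sum_rank_in_class l : injective_on_classes l ->
  (2 * \sum_e rank_in_class l e =
   \sum_e #|[set e' | (cls e' == cls e) && (e' != e)]|)%N.
Proof.
move=> injl; rewrite mul2n -addnn.
have rankE e : rank_in_class l e = (\sum_e' ((cls e' == cls e) && (l e' < l e)))%N.
  by rewrite /rank_in_class -sum1dep_card [LHS]big_mkcond; apply: eq_bigr => e' _; case: ifP.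
under eq_bigr do rewrite rankE; rewrite {2}exchange_big -big_split /=.
apply: eq_bigr => e _; rewrite -big_split -sum1dep_card [RHS]big_mkcond /=.
apply: eq_bigr => e' _; rewrite (eq_sym (cls e)).
case: eqP => [ce|] //=; have [->|ne] := eqVneq e' e; first by rewrite ltnn.
case: ltngtP => // /injl E; case/eqP: ne; exact: E.
Qed.

Definition class_height e : nat := #|[set e' | cls e' == cls e]|.

(** The labels of a class of height h are exactly 0, ..., h - 1: if all of them were below some i <
    h, injectivity would violate the pigeonhole principle. *)
Lemma class_label_exists l e i : injective_on_classes l -> down_closed l ->
  (i < class_height e)%N -> exists e', cls e' = cls e /\ l e' = i.
Proof.
move=> injl downl lt_i.
have [/existsP[e' /andP[/eqP ce le]]|] :=
    boolP [exists e', (cls e' == cls e) && (i <= l e')%N].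
  have [E|ne] := eqVneq i (l e'); first by exists e'.
  have [|e2 [c2 l2]] := downl e' i; first by rewrite ltn_neqAle ne.
  by exists e2; rewrite c2.
rewrite negb_exists => /forallP no_l; exfalso.
have lt_l e' : cls e' = cls e -> (l e' < i)%N.
  by move=> ce; have := no_l e'; rewrite ce eqxx /= -ltnNge.
have ipos : (0 < i)%N by apply: leq_ltn_trans (lt_l e erefl).
pose k e' : 'I_i := Ordinal (ltn_pmod (l e') ipos).
have inj_k : {in [set e' | cls e' == cls e] &, injective k}.
  move=> e1 e2; rewrite !inE => /eqP c1 /eqP c2 /(congr1 val) /=.
  by rewrite !modn_small ?lt_l // => /injl; apply; rewrite c1 c2.
have := max_card (mem (k @: [set e' | cls e' == cls e])).
by rewrite (card_in_imset inj_k) card_ord leqNgt lt_i.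
Qed.

Lemma rank_in_class_lt l e : (rank_in_class l e < class_height e)%N.
Proof.
apply: proper_card; apply/properP; split.
  by apply/fintype.subsetP => e'; rewrite !inE => /andP[].
by exists e; rewrite !inE ?eqxx ?ltnn.
Qed.

(* l dominates rank_in_class l, and the equality of the sums of l, lab and of  *)
(* both ranks forces l = rank_in_class l.                                      *)
Lemma class_relabelling l lab : injective_on_classes lab -> down_closed lab ->
  injective_on_classes l -> (\sum_e l e = \sum_e lab e)%N ->
  exists2 sigma : 'S_n, sigma \in fiber_stab cls & forall e, l e = lab (sigma e).
Proof.
move=> inj_lab down_lab inj_l sum_l.
have le_rank e : (rank_in_class l e <= l e)%N by apply: rank_in_class_le.
have ge_rank e : (lab e <= rank_in_class lab e)%N by apply: rank_in_class_ge.
have l_rank e : l e = rank_in_class l e.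
  have le_sum : (\sum_e l e <= \sum_e rank_in_class l e)%N.
    rewrite sum_l (leq_trans (leq_sum _ (fun i _ => ge_rank i))) //.
    by rewrite -(leq_pmul2l (m := 2)) // !sum_rank_in_class.
  have ge_sum : (\sum_(i | i != e) rank_in_class l i <= \sum_(i | i != e) l i)%N.
    by apply: leq_sum => i _.
  move: le_sum; rewrite (bigD1 e) //= [X in (_ <= X)%N](bigD1 e) //=.
  move=> le_sum; apply/eqP; rewrite eqn_leq le_rank andbT.
  rewrite -(leq_add2r (\sum_(i | i != e) l i)); apply: leq_trans le_sum _.
  by rewrite leq_add2l.
have /choice[h hE] e : exists e', cls e' = cls e /\ lab e' = l e.
  by apply: class_label_exists; rewrite ?l_rank ?rank_in_class_lt.
have inj_h : injective h.
  move=> e e' eq_h; have [c1 l1] := hE e; have [c2 l2] := hE e'.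
  by apply: inj_l; rewrite -?c1 -?l1 eq_h ?c2 ?l2.
exists (perm inj_h) => [|e]; last by rewrite permE; have [_ ->] := hE e.
by apply/fiber_stabP => e; rewrite permE; have [-> _] := hE e.
Qed.

End ColumnLabels.

(* The tableau g of shape s, with the element g k in position k, has the rows  *)
(* given by lab and the columns given by the classes of cls.                   *)
Definition is_frame (s : seq nat) n (g : 'S_n) (lab cls : 'I_n -> nat) : Prop :=
  (forall e, row_of s (g^-1%g e) = lab e) /\
  (forall e e', (col_of s (g^-1%g e) == col_of s (g^-1%g e')) = (cls e == cls e')).

Section Frame.
Variables (s : seq nat) (n : nat).

Lemma row_col_inj (k k' : 'I_n) :
  row_of s k = row_of s k' -> col_of s k = col_of s k' -> k = k'.
Proof.
rewrite /row_of /col_of => Er Ec; apply: val_inj => /=.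
by rewrite -(reshape_indexK s k) -(reshape_indexK s k') Er Ec.
Qed.

Lemma row_col_stab1 (p : 'S_n) :
  p \in row_stab s n -> p \in col_stab s n -> p = 1%g.
Proof.
rewrite row_stabE col_stabE => /fiber_stabP Rp /fiber_stabP Cp.
by apply/perm.permP => k; rewrite perm1; apply: row_col_inj.
Qed.

Variables (g0 : 'S_n) (lab cls : 'I_n -> nat).
Hypothesis frame : is_frame s g0 lab cls.
Hypothesis inj_lab : injective_on_classes cls lab.
Hypothesis down_lab : down_closed cls lab.

Lemma frame_conj (x : 'S_n) :
  ((g0 * x * g0^-1)%g \in col_stab s n) = (x \in fiber_stab cls).
Proof.
have [_ colE] := frame; rewrite col_stabE; apply/fiber_stabP/fiber_stabP => H k.
  have := H (g0^-1%g k); rewrite !permM permKV => /eqP.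
  by rewrite colE => /eqP.
by rewrite !permM; apply/eqP; rewrite -{2}(permK g0 k) colE H.
Qed.

(* f vanishes outside R C g0, because a labelling that is injective on the     *)
(* columns of g0 and has the same content as lab is a column permutation of    *)
(* lab; thus f is a multiple of the translate by g0 of the Young symmetrizer.  *)
Lemma antisym_in_specht (f : 'S_n -> algC) :
  (forall p g, p \in row_stab s n -> f (p * g)%g = f g) ->
  (forall x g, x \in fiber_stab cls -> f (g * x)%g = (-1) ^+ odd_perm x * f g) ->
  in_specht s f.
Proof.
move=> invf antif; have [rowE colE] := frame.
have decomp g : f g != 0 -> exists p q,
    [/\ p \in row_stab s n, q \in col_stab s n & g = (p * q * g0)%g].
  move=> nz; pose l e := row_of s (g^-1%g e).
  (* If two elements of a class had the same row, their swap would act on [g] both as a row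
     permutation, fixing [f g], and as a column permutation, changing its sign. *)
  have inj_l : injective_on_classes cls l.
    move=> e e' ce le; apply/eqP/negPn/negP => ne; case/eqP: nz.
    have tC : tperm e e' \in fiber_stab cls.
      by apply/fiber_stabP => k; case: tpermP => // ->.
    have := antif _ g tC; rewrite odd_tperm ne expr1 mulN1r.
    have -> : (g * tperm e e' = (g * tperm e e' * g^-1) * g)%g by rewrite mulgKV.
    rewrite invf; first by move/eqP; rewrite -addr_eq0 -mulr2n mulrn_eq0 /= => /eqP.
    rewrite row_stabE; apply/fiber_stabP => k; rewrite !permM -[RHS](congr1 _ (permK g k)).
    by case: tpermP => [->|->|] //; rewrite -?/(l _) ?le.
  have sum_l : (\sum_e l e = \sum_e lab e)%N.
    rewrite /l -(eq_bigr _ (fun e _ => rowE e)).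
    rewrite (reindex_inj (@perm_inj _ g)) [RHS](reindex_inj (@perm_inj _ g0)) /=.
    by apply: eq_bigr => k _; rewrite !permK.
  have [sigma sC lE] := class_relabelling inj_lab down_lab inj_l sum_l.
  exists (g * sigma * g0^-1)%g, (g0 * sigma^-1 * g0^-1)%g; split.
  - rewrite row_stabE; apply/fiber_stabP => k; rewrite !permM rowE -lE /l.
    by rewrite permK.
  - by rewrite frame_conj fiber_stabV.
  - by rewrite !mulgA mulgKV mulgKV mulgK.
(* The witness is [f g0] times the group element [g0]. The products of a row and a column
   permutation being distinct, at most one term of the double sum survives. *)
exists (fun g => (g == g0)%:R * f g0) => g.
set y := fun _ => _; have yE q p0 q0 : q \in col_stab s n -> q0 \in col_stab s n ->
    p0 \in row_stab s n -> y (q * (p0 * (q0 * g0)))%g = ((p0 == 1%g) && (q == q0^-1%g))%:R * f g0.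
  move=> Cq Cq0 Rp0; rewrite /y; congr (_%:R * _); congr nat_of_bool.
  apply/eqP/andP => [E|[/eqP-> /eqP->]]; last by rewrite mul1g mulKg.
  have E1 : (q * (p0 * q0) = 1)%g by apply: (mulIg g0); rewrite mul1g -!mulgA.
  have Cp0 : p0 \in col_stab s n.
    have -> : p0 = (q^-1 * q0^-1)%g.
      by apply: (mulgI q); apply: (mulIg q0); rewrite -mulgA E1 mulgA mulgV mul1g mulVg.
    by rewrite col_stabE fiber_stabM ?fiber_stabV.
  have p1 := row_col_stab1 Rp0 Cp0; move: E1; rewrite p1 mul1g eqxx => E1.
  by split=> //; apply/eqP; apply: (mulIg q0); rewrite mulVg.
have [nz|z] := eqVneq (f g) 0; last first.
  have [p [q [Rp Cq gE]]] := decomp g z.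
  rewrite gE -mulgA rowsym_inv // invf // /rowsym (bigD1 1%g) /=; last first.
    by rewrite row_stabE fiber_stab1.
  rewrite [X in _ + X]big1 ?addr0 => [|p0 /andP[Rp0 np0]]; last first.
    by rewrite /colsym big1 // => q1 Cq1; rewrite yE // (negPf np0) mul0r mulr0.
  rewrite /colsym (bigD1 q^-1%g) /=; last by rewrite col_stabE fiber_stabV.
  rewrite yE ?col_stabE ?fiber_stabV ?row_stabE ?fiber_stab1 // !eqxx mul1r odd_permV.
  rewrite big1 ?addr0 => [|q1 /andP[Cq1 nq1]]; last first.
    by rewrite yE ?row_stabE ?fiber_stab1 // (negPf nq1) andbF mul0r mulr0.
  have -> : (q * g0 = g0 * (g0^-1 * q * g0))%g by rewrite !mulgA mulgV mul1g.
  rewrite antif; first by rewrite -mulgA -conjgE odd_permJ.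
  by rewrite -frame_conj !mulgA mulgV mul1g mulgK.
rewrite nz /rowsym big1 // => p Rp; rewrite /colsym big1 // => q Cq.
rewrite /y; case: eqP => [E|]; last by rewrite mul0r mulr0.
suff -> : f g0 = 0 by rewrite !mulr0.
have gE : g = (p^-1 * (q^-1 * g0))%g by rewrite -E !mulgA mulgKV mulVg mul1g.
have := nz; rewrite gE invf ?row_stabE ?fiber_stabV //.
have -> : (q^-1 * g0 = g0 * (g0^-1 * q^-1 * g0))%g by rewrite !mulgA mulgV mul1g.
rewrite antif; last by rewrite -frame_conj !mulgA mulgV mul1g mulgK col_stabE fiber_stabV.
by move/eqP; rewrite mulf_eq0 signr_eq0 => /eqP.
Qed.

End Frame.

Lemma partition_of_counts a (f : nat -> nat) :
  (forall i, f i.+1 <= f i)%N -> (forall i, (a <= i)%N -> f i = 0%N) ->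
  exists s, [/\ is_partition s, (size s <= a)%N, forall i, nth 0%N s i = f i
    & sumn s = (\sum_(i < a) f i)%N].
Proof.
elim: a f => [|a IH] f decf f0.
  by exists [::]; split=> // [i|]; rewrite ?nth_nil ?f0 // big_ord0.
have [f00|fpos] := posnP (f 0%N).
  have fz i : f i = 0%N.
    by elim: i => // i IHi; apply/eqP; rewrite -leqn0 -IHi.
  by exists [::]; split=> // [i|]; rewrite ?nth_nil ?fz // big1.
have [s [/andP[sorted_s s0] size_s nth_s sum_s]] :=
  IH (fun i => f i.+1) (fun i => decf _) (fun i ai => f0 i.+1 ai).
exists (f 0%N :: s); split.
- apply/andP; split; last by rewrite inE negb_or neq_ltn fpos.
  case: s sorted_s nth_s {s0 size_s sum_s} => [|x s] //= -> /(_ 0%N) /= ->.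
  by rewrite andbT; apply: decf.
- by [].
- by case=> [|i] //=; rewrite nth_s.
- by rewrite /= sum_s big_ord_recl.
Qed.

(* In the tableau built here, the columns are the classes sorted by decreasing *)
(* height.                                                                     *)
Section FrameExists.
Variables (n : nat) (lab cls : 'I_n -> nat).
Hypothesis inj_lab : injective_on_classes cls lab.
Hypothesis down_lab : down_closed cls lab.

Local Notation ht := (class_height cls).

Definition class_before e' e : bool :=
  (ht e < ht e')%N || (ht e' == ht e) && (cls e' < cls e)%N.

Lemma class_before_irr e e' : cls e = cls e' -> class_before e e' = false.
Proof. by move=> E; rewrite /class_before E ltnn andbF orbF /class_height E ltnn. Qed.

Lemma class_before_trans : transitive class_before.
Proof. rewrite /class_before => y x z; lia. Qed.

Lemma class_before_total e e' : cls e != cls e' -> class_before e e' || class_before e' e.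
Proof. rewrite /class_before => /eqP; lia. Qed.

Lemma class_before_l e1 e2 e : cls e1 = cls e2 -> class_before e1 e = class_before e2 e.
Proof. by move=> E; rewrite /class_before /class_height E. Qed.

Lemma class_before_r e1 e2 e : cls e1 = cls e2 -> class_before e e1 = class_before e e2.
Proof. by move=> E; rewrite /class_before /class_height E. Qed.

Definition class_rank e : nat := #|[set e' | (lab e' == lab e) && class_before e' e]|.

(** The columns before that of [e1] are at least as high, so they meet all the rows that it meets,
    and counting them along any of these rows gives the same number. *)
Lemma class_rank_const e1 e2 : cls e1 = cls e2 -> class_rank e1 = class_rank e2.
Proof.
suff le f1 f2 : cls f1 = cls f2 -> (class_rank f1 <= class_rank f2)%N.
  by move=> E; apply/eqP; rewrite eqn_leq !le.
move=> E; rewrite /class_rank.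
have /choice[h hE] e : exists e', (lab e == lab f1) && class_before e f1 ->
    cls e' = cls e /\ lab e' = lab f2.
  have [/andP[/eqP le be]|] := boolP ((lab e == lab f1) && class_before e f1); last by exists e.
  have [|e' [c' l']] := class_label_exists (e := e) (i := lab f2) inj_lab down_lab.
    apply: (@leq_trans (ht f2)).
      by apply: leq_ltn_trans (rank_in_class_ge _ down_lab) (rank_in_class_lt _ _ _).
    move: be; rewrite /class_before; have -> : ht f1 = ht f2 by rewrite /class_height E.
    by case/orP => [/ltnW //|/andP[/eqP->]].
  by exists e'.
rewrite -(card_in_imset (f := h)).
  apply/subset_leq_card/fintype.subsetP => z /imsetP[e + ->]; rewrite inE => be.
  have [c' l'] := hE _ be; rewrite inE l' eqxx /=.
  by rewrite (class_before_l _ c') -(class_before_r _ E); case/andP: be.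
move=> e e'; rewrite !inE => be be' eq_h.
have [c l] := hE _ be; have [c' l'] := hE _ be'.
apply: inj_lab; first by rewrite -c -c' eq_h.
by case/andP: be => /eqP -> _; case/andP: be' => /eqP.
Qed.

(** The ranks are compared along row 0, which every column meets and where the order of the columns
    is total. *)
Lemma class_rank_inj e1 e2 : class_rank e1 = class_rank e2 -> cls e1 = cls e2.
Proof.
have zero e : exists e', cls e' = cls e /\ lab e' = 0%N.
  have [l0|lpos] := posnP (lab e); first by exists e.
  exact: down_lab lpos.
have [f1 [c1 l1]] := zero e1; have [f2 [c2 l2]] := zero e2.
rewrite -(class_rank_const c1) -(class_rank_const c2) -c1 -c2 => Er.
apply/eqP/negPn/negP => /class_before_total.
have lt e e' : lab e = 0%N -> lab e' = 0%N -> class_before e e' ->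
    (class_rank e < class_rank e')%N.
  move=> le le' be; apply: proper_card; apply/properP; split.
    apply/fintype.subsetP => x; rewrite !inE le le' => /andP[-> bx].
    exact: class_before_trans bx be.
  by exists e; rewrite !inE ?le ?le' ?be // class_before_irr ?andbF.
by case/orP => b; [have := lt _ _ l1 l2 b|have := lt _ _ l2 l1 b]; rewrite Er ltnn.
Qed.

Lemma frame_exists a : (forall e, lab e < a)%N ->
  exists s g, [/\ is_partition s, (size s <= a)%N, sumn s = n,
    forall i, nth 0%N s i = #|[set e | lab e == i]| & is_frame s g lab cls].
Proof.
move=> lt_lab; have [i|i le_ai|s [part_s size_s nth_s sum_s]] :=
    @partition_of_counts a (fun i => #|[set e | lab e == i]|).
- have /choice[h hE] e : exists e', lab e == i.+1 -> cls e' = cls e /\ lab e' = i.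
    case: eqP => [le|_]; last by exists e.
    by have [|e' ?] := down_lab (e := e) (i := i); rewrite ?le //; exists e'.
  rewrite -(card_in_imset (f := h)).
    apply/subset_leq_card/fintype.subsetP => z /imsetP[e + ->]; rewrite inE => be.
    by have [_ l'] := hE _ be; rewrite inE l'.
  move=> e e'; rewrite !inE => be be' eq_h.
  have [c l] := hE _ be; have [c' l'] := hE _ be'.
  apply: inj_lab; first by rewrite -c -c' eq_h.
  by rewrite (eqP be) (eqP be').
- apply/eqP; rewrite cards_eq0; apply/eqP/setP => e; rewrite !inE.
  by apply: contraTF (lt_lab e) => /eqP->; rewrite -leqNgt.
have sum_sn : sumn s = n.
  rewrite sum_s -[RHS]card_ord -sum1_card.
  rewrite (partition_big (fun e => Ordinal (lt_lab e)) predT) //=.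
  by apply: eq_bigr => i _; rewrite -sum1dep_card; apply: eq_bigl => e.
have lt_rank e : (class_rank e < nth 0%N s (lab e))%N.
  rewrite nth_s; apply: proper_card; apply/properP; split.
    by apply/fintype.subsetP => x; rewrite !inE => /andP[].
  by exists e; rewrite !inE ?eqxx // class_before_irr ?andbF.
have lt_h e : (flatten_index s (lab e) (class_rank e) < n)%N.
  by rewrite -[X in (_ < X)%N]sum_sn; apply: flatten_indexP.
pose h e := Ordinal (lt_h e).
have row_h e : row_of s (h e) = lab e by apply: flatten_indexKl.
have col_h e : col_of s (h e) = class_rank e by apply: flatten_indexKr.
have inj_h : injective h.
  move=> e e' eq_h; apply: inj_lab; last by rewrite -!row_h eq_h.
  by apply: class_rank_inj; rewrite -!col_h eq_h.
exists s, (perm inj_h)^-1%g; split=> //; rewrite /is_frame invgK; split=> e.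
  by rewrite permE row_h.
move=> e'; rewrite !permE !col_h; apply/eqP/eqP => [/class_rank_inj //|].
exact: class_rank_const.
Qed.

End FrameExists.

Lemma rank_in_class_inj n (cls l : 'I_n -> nat) e e' : cls e = cls e' ->
  rank_in_class cls l e = rank_in_class cls l e' -> l e = l e'.
Proof.
have lt f f' : cls f = cls f' -> (l f < l f')%N ->
    (rank_in_class cls l f < rank_in_class cls l f')%N.
  move=> cf lf; apply: proper_card; apply/properP; split.
    by apply/fintype.subsetP => x; rewrite !inE cf => /andP[-> /ltn_trans]; apply.
  by exists f; rewrite !inE ?cf ?eqxx ?ltnn.
move=> ce Er; case: (ltngtP (l e) (l e')) => // [/(lt _ _ ce)|/(lt _ _ (esym ce))];
  by rewrite Er ltnn.
Qed.

(** Replacing each label [l e] by its rank in the class can only lower it, and that rank is the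
    label by [lab] of some element of the same class. This is the bound min (h, r) on the labels
    below r in a column of height h, summed over the columns. *)
Lemma card_below_le n (cls l lab : 'I_n -> nat) m : injective_on_classes cls l ->
  injective_on_classes cls lab -> down_closed cls lab ->
  (#|[set e | l e < m]| <= #|[set e | lab e < m]|)%N.
Proof.
move=> inj_l inj_lab down_lab.
have /choice[h hE] e : exists e', cls e' = cls e /\ lab e' = rank_in_class cls l e.
  by apply: class_label_exists; rewrite // rank_in_class_lt.
rewrite -(card_in_imset (f := h)).
  apply/subset_leq_card/fintype.subsetP => z /imsetP[e + ->]; rewrite !inE => lt_e.
  by have [_ ->] := hE e; apply: leq_ltn_trans (rank_in_class_le _ inj_l) lt_e.
move=> e e' _ _ eq_h; have [c l1] := hE e; have [c' l1'] := hE e'.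
have ce : cls e = cls e' by rewrite -c -c' eq_h.
by apply: inj_l => //; apply: (rank_in_class_inj ce); rewrite -l1 -l1' eq_h.
Qed.

(** * Boxes of a Young diagram, and the labelling given by an invariant *)

Section Positions.
Variables (s : seq nat) (n : nat).
Hypothesis sum_s : sumn s = n.

Lemma position_exists i c : (c < nth 0%N s i)%N ->
  exists k : 'I_n, row_of s k = i /\ col_of s k = c.
Proof.
move=> lt_c; have lt_k : (flatten_index s i c < n)%N by rewrite -sum_s flatten_indexP.
by exists (Ordinal lt_k); split; [apply: flatten_indexKl|apply: flatten_indexKr].
Qed.

Lemma col_of_lt (k : 'I_n) : (col_of s k < nth 0%N s (row_of s k))%N.
Proof. by apply: reshape_offsetP; rewrite sum_s. Qed.

Lemma row_of_lt (k : 'I_n) : (row_of s k < size s)%N.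
Proof. by apply: reshape_indexP; rewrite sum_s. Qed.

Lemma card_row i : #|[set k : 'I_n | row_of s k == i]| = nth 0%N s i.
Proof.
have /choice[h hE] : forall c : 'I_(nth 0%N s i), exists k : 'I_n,
  row_of s k = i /\ col_of s k = c by move=> c; apply: position_exists.
have inj_h : injective h.
  move=> c c' E; apply: val_inj => /=.
  by have [_ <-] := hE c; have [_ <-] := hE c'; rewrite E.
rewrite -[RHS]card_ord -(card_codom inj_h); apply: eq_card => k; rewrite inE.
apply/eqP/codomP => [rk|[c ->]]; last by have [] := hE c.
have lt_c : (col_of s k < nth 0%N s i)%N by rewrite -rk col_of_lt.
exists (Ordinal lt_c); have [r c] := hE (Ordinal lt_c).
by apply: (@row_col_inj s); rewrite ?r ?c.
Qed.

Lemma inj_row_col : injective_on_classes (@col_of s n) (@row_of s n).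
Proof. by move=> e e' ce re; apply: (@row_col_inj s). Qed.

Lemma is_partition_nth i i' : is_partition s -> (i <= i')%N -> (nth 0%N s i' <= nth 0%N s i)%N.
Proof.
case/andP=> sorted_s _ le_i; have [lt_i|ge_i] := ltnP i' (size s).
  have geq_trans : transitive geq by move=> y x z /= xy yz; apply: leq_trans yz xy.
  have geq_refl : reflexive geq by move=> x /=.
  by apply: (sorted_leq_nth geq_trans geq_refl 0%N sorted_s);
     rewrite // inE (leq_ltn_trans le_i).
by rewrite nth_default.
Qed.

Lemma down_row_col : is_partition s -> down_closed (@col_of s n) (@row_of s n).
Proof.
move=> part_s e i lt_i.
have lt_c : (col_of s e < nth 0%N s i)%N.
  by apply: leq_trans (col_of_lt e) (is_partition_nth part_s (ltnW lt_i)).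
by have [k [rk ck]] := position_exists lt_c; exists k.
Qed.

End Positions.

(** The labels of the box [e] of [u] are the rows of the entry [g3 e] in the tableaux [g1] and [g2],
    at a point where the column antisymmetrization of the invariant does not vanish. *)
Lemma kronecker_labelling n (s t u : seq nat) :
  sumn s = n -> sumn t = n -> sumn u = n -> kronecker s t u != 0%N ->
  exists I J : 'I_n -> nat,
    [/\ forall i, #|[set e | I e == i]| = nth 0%N s i,
        forall j, #|[set e | J e == j]| = nth 0%N t j
      & forall e e', col_of u e = col_of u e' -> I e = I e' -> J e = J e' -> e = e'].
Proof.
move=> sn tn un /(kronecker_neq0P sn tn un)[F [[Fs Ft Fu Finv] [g1 [g2 [g0 nzF]]]]].
have [g3 nz] : exists g3, colsym u (F g1 g2) g3 != 0.
  apply: contrapT => no_g; case/eqP: nzF.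
  apply: (specht_colsym_eq0 (Fu g1 g2)) => g; apply/eqP/negPn/negP => nz.
  by apply: no_g; exists g.
have card_lab r : sumn r = n -> forall (g : 'S_n) i,
    #|[set e | row_of r (g^-1%g (g3 e)) == i]| = nth 0%N r i.
  move=> rn g i; rewrite -(card_row rn i).
  rewrite -(card_imset _ (@perm_inj _ (g3 * g^-1)%g)); apply: eq_card => k.
  rewrite !inE; apply/imsetP/idP => [[e + ->]|rk]; first by rewrite inE permM.
  by exists ((g3 * g^-1)^-1%g k); rewrite ?permKV // inE -permM permKV.
exists (fun e => row_of s (g1^-1%g (g3 e))), (fun e => row_of t (g2^-1%g (g3 e))).
split; [exact: card_lab|exact: card_lab|move=> e e' ce Ie Je].
apply/eqP/negPn/negP => ne; case/eqP: nz.
have tC : tperm e e' \in col_stab u n.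
  by rewrite col_stabE; apply/fiber_stabP => k; case: tpermP => // ->.
have := colsym_anti (F g1 g2) g3 tC; rewrite odd_tperm ne expr1 mulN1r.
pose x := (g3^-1 * tperm e e' * g3)%g.
have stab r (g : 'S_n) : row_of r (g^-1%g (g3 e)) = row_of r (g^-1%g (g3 e')) ->
    (g * x^-1 * g^-1)%g \in row_stab r n.
  move=> E; rewrite row_stabE; apply/fiber_stabP => k.
  rewrite /x !invMg invgK tpermV !permM.
  rewrite -[in RHS](permK g k) -[in RHS](permKV g3 (g k)).
  by case: tpermP => // ->; rewrite E.
have -> : colsym u (F g1 g2) (tperm e e' * g3)%g = colsym u (F g1 g2) g3.
  apply: eq_bigr => q _; congr (_ * _).
  (* The swap becomes a right translation by its conjugate [x]; invariance moves it to [g1] and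
     [g2], where equal labels make it a row permutation. *)
  have -> : (q * (tperm e e' * g3) = q * g3 * x)%g by rewrite /x !mulgA mulgK.
  rewrite -[in LHS](mulgKV x g1) -[in LHS](mulgKV x g2) Finv.
  rewrite -[(g1 / x)%g](mulgKV g1) -[(g2 / x)%g](mulgKV g2).
  by rewrite (in_specht_row _ (Fs _ _)) ?stab // (in_specht_row _ (Ft _ _)) ?stab.
by move/eqP; rewrite -addr_eq0 -mulr2n mulrn_eq0 => /eqP.
Qed.

Lemma psumr_gt0_at (I : finType) (P : pred I) (F : I -> algC) i0 :
  P i0 -> (forall i, P i -> 0 <= F i) -> 0 < F i0 -> 0 < \sum_(i | P i) F i.
Proof.
move=> P0 F0 F1; rewrite (bigD1 i0) //=; apply: ltr_wpDr => //.
by apply: sumr_ge0 => i /andP[/F0].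
Qed.

(** * Nonvanishing of Kronecker coefficients *)

Section Construct.
Variables (n : nat) (s t u : seq nat).
Hypotheses (sum_s : sumn s = n) (sum_t : sumn t = n) (sum_u : sumn u = n).
Implicit Types (I J : 'I_n -> nat) (g : 'S_n).

(** The box [k] of the tableau [g3] is labelled by the row of its entry in the tableau [g]. A
    function of such labellings is automatically invariant under simultaneous right translation. *)
Definition pull (r : seq nat) g g3 : 'I_n -> nat := fun k => row_of r (g^-1%g (g3 k)).

Definition col_antisym (f : ('I_n -> nat) -> ('I_n -> nat) -> algC) : Prop :=
  forall q I J, q \in col_stab u n ->
    f (fun k => I (q k)) (fun k => J (q k)) = (-1) ^+ odd_perm q * f I J.

Lemma pullM r (g g3 h : 'S_n) : pull r (g * h)%g (g3 * h)%g = pull r g g3.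
Proof. by apply: funext => k; rewrite /pull invMg !permM permK. Qed.

Lemma pull_row r (p g g3 : 'S_n) : p \in row_stab r n -> pull r (p * g)%g g3 = pull r g g3.
Proof.
move=> Rp; apply: funext => k; rewrite /pull invMg permM.
have : p^-1%g \in fiber_stab (@row_of r n) by rewrite fiber_stabV.
by move/fiber_stabP ->.
Qed.

(* The invariant is (1 (x) a_t b_t (x) a_u) f; by positivity it is enough that *)
(* (1 (x) b_t (x) a_u) f has a nonzero value.                                  *)
Lemma kronecker_construct f : col_antisym f ->
  (forall g2 g3, in_specht s (fun g => f (pull s g g3) (pull t g2 g3))) ->
  (exists g1 g2, \sum_(q in col_stab t n) (-1) ^+ odd_perm q *
     (\sum_(p in row_stab u n) f (pull s g1 p) (pull t (q * g2)%g p)) != 0) ->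
  exists F, kron_invariant s t u F /\ exists g1 g2 g3, F g1 g2 g3 != 0.
Proof.
move=> antif Sf [g1 [g2 nz]].
pose F1 g1 g2 g3 := rowsym u (fun g => f (pull s g1 g) (pull t g2 g)) g3.
pose F2 g1 g2 g3 := rowsym t (colsym t (fun g => F1 g1 g g3)) g2.
have Su h1 h2 : in_specht u (fun g => F1 h1 h2 g).
  pose h g := f (pull s h1 g) (pull t h2 g).
  (* [h] is already antisymmetric, so [colsym] only multiplies it by the order of the column
     stabilizer, which is divided out. *)
  exists (fun g => #|col_stab u n|%:R^-1 * h g) => g; apply: rowsym_ext => g'.
  have anti q g0 : q \in col_stab u n -> #|col_stab u n|%:R^-1 * h (q * g0)%g =
      (-1) ^+ odd_perm q * (#|col_stab u n|%:R^-1 * h g0).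
    move=> Cq; rewrite mulrCA; congr (_ * _); rewrite /h -antif //.
    by congr f; apply: funext => k; rewrite /pull permM.
  by rewrite (colsym_id anti) mulVKf // card_col_neq0.
exists F2; split; last first.
  exists g1; apply: contrapT => F2z; case/eqP: nz.
  rewrite -[LHS]/(colsym t (fun g => \sum_(p in row_stab u n) f (pull s g1 p) (pull t g p)) g2).
  have -> : (fun g => \sum_(p in row_stab u n) f (pull s g1 p) (pull t g p)) =
      (fun g => F1 g1 g 1%g).
    by apply: funext => g; apply: eq_bigr => p _; rewrite mulg1.
  apply: rowsym_colsym_eq0 => [p g Rp|g].
    by apply: eq_bigr => p' _; rewrite pull_row.
  by apply/eqP/negPn/negP => nz; apply: F2z; exists g, 1%g.
split.
- move=> h2 h3.
  apply: (in_specht_ext (f := fun g => \sum_(p in row_stab t n) 1 *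
      (\sum_(q in col_stab t n) (-1) ^+ odd_perm q *
        (\sum_(p' in row_stab u n) 1 *
           f (pull s g (p' * h3)%g) (pull t (q * (p * h2))%g (p' * h3)%g))))).
    move=> g; rewrite /F2 /rowsym; apply: eq_bigr => p _; rewrite mul1r.
    apply: eq_bigr => q _; congr (_ * _).
    by apply: eq_bigr => p' _; rewrite mul1r.
  by do 3![apply: in_specht_sum => ? _].
- by move=> h1 h3; exists (fun g => F1 h1 g h3).
- move=> h1 h2.
  apply: (in_specht_ext (f := fun g => \sum_(p in row_stab t n) 1 *
      (\sum_(q in col_stab t n) (-1) ^+ odd_perm q * F1 h1 (q * (p * h2))%g g))).
    by move=> g; apply: eq_bigr => p _; rewrite mul1r.
  by do 2![apply: in_specht_sum => ? _].
- move=> h h1 h2 h3; apply: eq_bigr => p _; apply: eq_bigr => q _; congr (_ * _).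
  by apply: eq_bigr => p' _; rewrite !mulgA !pullM.
Qed.

(** The antisymmetrization over the columns of [u] of the indicator function of the pair
    [(i0, j0)]. *)
Definition col_orbit (i0 j0 I J : 'I_n -> nat) : algC :=
  \sum_(q in col_stab u n) (-1) ^+ odd_perm q *
    ([forall k, (I k == i0 (q k)) && (J k == j0 (q k))])%:R.

Lemma col_orbit_antisym i0 j0 : col_antisym (col_orbit i0 j0).
Proof.
move=> q I J Cq; rewrite /col_orbit (reindex_inj (mulgI q)) mulr_sumr /=.
apply: eq_big => [r|r _]; first by rewrite col_stabE fiber_stabMl.
rewrite odd_permM signr_addb -mulrA; congr (_ * (_ * _)); congr (_%:R); congr nat_of_bool.
apply/forallP/forallP => H k; last by rewrite permM.
by have := H (q^-1 k)%g; rewrite permM permKV.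
Qed.

(** Unless [J] is a column permutation of [j0], the function is 0. Otherwise the frame [g1] is
    transported by [m]; permutations inside its classes preserve [J] and the columns of [u], so they
    act by their sign and [antisym_in_specht] applies. *)
Lemma col_orbit_in_specht g1 (i0 j0 cls : 'I_n -> nat) J g3 :
  is_frame s g1 i0 cls -> injective_on_classes cls i0 -> down_closed cls i0 ->
  (forall e e', cls e = cls e' -> j0 e = j0 e' /\ col_of u e = col_of u e') ->
  in_specht s (fun g => col_orbit i0 j0 (pull s g g3) J).
Proof.
move=> [rowE colE] inj_i down_i clsE.
have [[q0 Cq0 JE]|no_q] := EM (exists2 q, q \in col_stab u n & J = fun k => j0 (q k)); last first.
  exists (fun=> 0) => g; rewrite /col_orbit big1 => [|q Cq].
    rewrite /rowsym big1 // => p _.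
    by rewrite /colsym big1 // => q _; rewrite mulr0.
  case: forallP => [H|_]; last by rewrite mulr0.
  case: no_q; exists q => //; apply: funext => k.
  by have /andP[_ /eqP] := H k.
pose m := (g3^-1 * q0)%g.
apply: (@antisym_in_specht _ _ (g1 * m^-1)%g (fun e => i0 (m e)) (fun e => cls (m e))).
- split=> [e|e e']; rewrite !invMg !invgK !permM; first by rewrite rowE.
  by rewrite colE.
- by move=> e e' ce ie; apply: (@perm_inj _ m); apply: inj_i.
- move=> e i /down_i[e' [ce' ie']]; exists (m^-1%g e'); rewrite permKV.
  by split.
- by move=> p g Rp; rewrite pull_row.
move=> x g xC.
pose x' := (g3 * x^-1 * g3^-1)%g.
have clsx' k : cls (q0 (x' k)) = cls (q0 k).
  have : x^-1%g \in fiber_stab (fun e => cls (m e)) by rewrite fiber_stabV.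
  by move/fiber_stabP/(_ (g3 k)); rewrite /x' /m !permM permK.
have Cx' : x' \in col_stab u n.
  rewrite col_stabE; apply/fiber_stabP => k; have [_] := clsE _ _ (clsx' k).
  by move: Cq0; rewrite col_stabE => /fiber_stabP qC; rewrite !qC.
have -> : pull s (g * x)%g g3 = fun k => pull s g g3 (x' k).
  by apply: funext => k; rewrite /pull /x' invMg !permM permKV.
have {1}-> : J = fun k => J (x' k).
  by apply: funext => k; rewrite JE; have [] := clsE _ _ (clsx' k).
rewrite col_orbit_antisym //; congr (_ ^+ nat_of_bool _ * _).
by rewrite /x' !odd_permM !odd_permV; case: (odd_perm g3); case: (odd_perm x).
Qed.

Lemma frame_row_stab g2 (j1 cls : 'I_n -> nat) (q p : 'S_n) :
  is_frame t g2 j1 cls ->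
  pull t (q * g2)%g p = fun k => j1 ((g2^-1 * q^-1 * g2)%g (p k)).
Proof.
move=> [rowE _]; apply: funext => k; rewrite -rowE /pull.
by rewrite invMg !permM permK.
Qed.

(** The criterion of [kronecker_construct] is evaluated at the frames themselves; conjugation by
    [g2] turns the column stabilizer of [t] into the stabilizer of the classes [cls2]. *)
Lemma kronecker_frames f g1 g2 (i0 j1 cls1 cls2 : 'I_n -> nat) : col_antisym f ->
  (forall J g3, in_specht s (fun g => f (pull s g g3) J)) ->
  is_frame s g1 i0 cls1 -> is_frame t g2 j1 cls2 ->
  \sum_(x in fiber_stab cls2) \sum_(p in row_stab u n)
    (-1) ^+ odd_perm x * f (fun k => i0 (p k)) (fun k => j1 (x (p k))) != 0 ->
  kronecker s t u != 0%N.
Proof.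
move=> antif Sf frame1 frame2 nz; apply/(kronecker_neq0P sum_s sum_t sum_u).
apply: (kronecker_construct antif) => [g2' g3|]; first exact: Sf.
exists g1, g2; apply: contraNneq nz => E0; apply/eqP; apply: etrans E0.
rewrite [RHS](reindex_inj (can_inj (conjgK g2^-1%g))) [RHS](reindex_inj invg_inj) /=.
apply: eq_big => [x|x _].
  by rewrite conjgE invgK mulgA (frame_conj frame2) fiber_stabV.
rewrite mulr_sumr odd_permJ odd_permV; apply: eq_bigr => p _; congr (_ * f _ _).
  by case: frame1 => rowE _; apply: funext => k; rewrite /pull rowE.
rewrite (frame_row_stab _ _ frame2); apply: funext => k; congr (j1 _).
by rewrite conjgE invgK !invMg !invgK !mulgA mulVg mul1g mulgKV.
Qed.

End Construct.

(** * Nonvanishing by sums whose nonzero terms have the same sign *)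

Lemma signr_mul_eq (b1 b2 b : bool) : (b -> b1 = b2) ->
  (-1) ^+ b1 * ((-1) ^+ b2 * b%:R) = b%:R :> algC.
Proof. by case: b => [->|_] //; rewrite ?signrMK // !mulr0. Qed.

(** The pairs [(i0 e, j0 e)] are the boxes of a Young diagram, [s] and [t] are its row and column
    lengths. A nonzero term forces [x = q], since [x] preserves [i0] and a box is determined by its
    coordinates; its two signs cancel, and the identity contributes 1. *)
Lemma kronecker_single_column a b n (i0 j0 : 'I_n -> nat) :
  (forall e, i0 e < a)%N -> (forall e, j0 e < b)%N ->
  injective_on_classes j0 i0 -> down_closed j0 i0 -> down_closed i0 j0 ->
  exists s t, [/\ [/\ is_partition s, is_partition t, (size s <= a)%N & (size t <= b)%N],
    forall i, nth 0%N s i = #|[set e | i0 e == i]|,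
    forall j, nth 0%N t j = #|[set e | j0 e == j]|,
    sumn s = n & sumn t = n /\ kronecker s t (nseq n 1%N) != 0%N].
Proof.
move=> lti ltj inj_i down_i down_j.
have inj_j : injective_on_classes i0 j0 by move=> e e' ie je; apply: inj_i.
have [s [g1 [part_s size_s sum_s nth_s frame1]]] := frame_exists inj_i down_i lti.
have [t [g2 [part_t size_t sum_t nth_t frame2]]] := frame_exists inj_j down_j ltj.
exists s, t; split=> //; split=> //.
set u := nseq n 1%N; have sum_u : sumn u = n by rewrite sumn_nseq mul1n.
have col0 (k : 'I_n) : col_of u k = 0%N.
  by have := col_of_lt sum_u k; rewrite nth_nseq; case: ifP => // _; case: col_of.
have row1 (p : 'S_n) : p \in row_stab u n -> p = 1%g.
  rewrite row_stabE => /fiber_stabP pR; apply/perm.permP => k; rewrite perm1.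
  by apply: (@row_col_inj u); rewrite ?col0.
apply: (kronecker_frames sum_s sum_t sum_u (f := col_orbit u i0 j0) _ _ frame1 frame2).
- exact: col_orbit_antisym.
- move=> J g3; apply: (col_orbit_in_specht _ _ frame1) => // e e' -> .
  by rewrite !col0.
have termE (x p q : 'S_n) : x \in fiber_stab i0 -> p \in row_stab u n ->
    (-1) ^+ odd_perm x * ((-1) ^+ odd_perm q *
      [forall k, (i0 (p k) == i0 (q k)) && (j0 (x (p k)) == j0 (q k))]%:R) =
    [forall k, (i0 (p k) == i0 (q k)) && (j0 (x (p k)) == j0 (q k))]%:R :> algC.
  move=> /fiber_stabP xC /row1 ->; apply: signr_mul_eq => /forallP H.
  congr odd_perm; apply/perm.permP => k; have /andP[/eqP ik /eqP jk] := H k.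
  by rewrite perm1 in ik jk; apply: inj_i => //; rewrite xC.
have nneg (x p q : 'S_n) : x \in fiber_stab i0 -> p \in row_stab u n ->
    0 <= (-1) ^+ odd_perm x * ((-1) ^+ odd_perm q *
      [forall k, (i0 (p k) == i0 (q k)) && (j0 (x (p k)) == j0 (q k))]%:R) :> algC.
  by move=> xC pR; rewrite termE ?ler0n.
rewrite gt_eqF //; apply: (psumr_gt0_at (i0 := 1%g)); first exact: fiber_stab1.
  move=> x xC; apply: sumr_ge0 => p pR; rewrite /col_orbit mulr_sumr.
  by apply: sumr_ge0 => q _; apply: nneg.
apply: (psumr_gt0_at (i0 := 1%g)).
- by rewrite row_stabE fiber_stab1.
- move=> p pR; rewrite /col_orbit mulr_sumr.
  by apply: sumr_ge0 => q _; apply: nneg => //; apply: fiber_stab1.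
rewrite /col_orbit mulr_sumr; apply: (psumr_gt0_at (i0 := 1%g)).
- by rewrite col_stabE fiber_stab1.
- by move=> q _; apply: nneg; rewrite ?row_stabE fiber_stab1.
rewrite termE ?row_stabE ?fiber_stab1 //; case: forallP => [_|[]]; first exact: ltr01.
by move=> k; rewrite !perm1 !eqxx.
Qed.

(** Rows have at most two elements, so [p] is a product of disjoint row swaps, counted by their
    elements in column 0. The induction removes one swap at a time. *)
Lemma two_column_sign n (row c : 'I_n -> nat) (p : 'S_n) :
  (forall e, c e < 2)%N -> (forall e e', row e = row e' -> c e = c e' -> e = e') ->
  (forall e, row (p e) = row e) ->
  odd_perm p = odd #|[set e | (c e == 0%N) && (c (p e) == 1%N)]|.
Proof.
move=> lt_c inj_rc; move: {2}#|_| (erefl #|[set e | (c e == 0%N) && (c (p e) == 1%N)]|) => m.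
elim: m p => [|m IH] p cardE rowp.
  rewrite cardE; have fix0 e : c e = 0%N -> p e = e.
    move=> ce; apply: inj_rc => //; rewrite ce; apply/eqP.
    have : e \notin [set e | (c e == 0%N) && (c (p e) == 1%N)].
      by move/eqP: cardE; rewrite cards_eq0 => /eqP->; rewrite inE.
    by rewrite inE ce eqxx /=; have := lt_c (p e); case: (c (p e)) => [|[|]].
  suff -> : p = 1%g by rewrite odd_perm1.
  apply/perm.permP => e; rewrite perm1.
  have [/fix0 //|c1] := eqVneq (c e) 0%N.
  have [/fix0 /perm_inj //|c2] := eqVneq (c (p e)) 0%N.
  apply: inj_rc => //; move: c1 c2; have := lt_c e; have := lt_c (p e); lia.
have [x] : exists x, x \in [set e | (c e == 0%N) && (c (p e) == 1%N)].
  by apply/set0Pn; rewrite -cards_eq0 cardE.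
rewrite inE => /andP[/eqP cx /eqP cpx].
have xpx : x != p x by apply/eqP => E; move: cpx; rewrite -E cx.
have ppx : p (p x) = x.
  have ne : p (p x) != p x by apply: contra xpx => /eqP/perm_inj->.
  apply: (inj_rc _ _); rewrite ?rowp // cx; apply/eqP.
  have: c (p (p x)) != 1%N.
    apply: contra ne => /eqP cpp; apply/eqP.
    by apply: (inj_rc _ _); rewrite ?rowp ?cpx.
  by have := lt_c (p (p x)); case: (c (p (p x))) => [|[|]].
pose p' := (tperm x (p x) * p)%g.
have p'x : p' x = x by rewrite permM tpermL.
have p'px : p' (p x) = p x by rewrite permM tpermR.
have p'E e : e != x -> e != p x -> p' e = p e.
  by move=> ne1 ne2; rewrite permM tpermD // eq_sym.
have setE : [set e | (c e == 0%N) && (c (p' e) == 1%N)] =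
    [set e | (c e == 0%N) && (c (p e) == 1%N)] :\ x.
  apply/setP => e; rewrite !inE.
  have [->|ne1] := eqVneq e x; first by rewrite p'x cx.
  have [->|ne2] := eqVneq e (p x); first by rewrite cpx.
  by rewrite p'E.
have cardE' : #|[set e | (c e == 0%N) && (c (p' e) == 1%N)]| = m.
  have := cardsD1 x [set e | (c e == 0%N) && (c (p e) == 1%N)].
  by rewrite -setE inE cx cpx cardE => -[].
have odd_p' : odd_perm p' = ~~ odd_perm p by rewrite odd_permM odd_tperm xpx.
rewrite cardE /= -cardE' -IH // ?odd_p' ?negbK //.
by move=> e; rewrite permM; case: tpermP => [->|->|_ _]; rewrite !rowp.
Qed.

(* Here u has two columns, of heights h 0 and h 1, and r1 is the number of a   *)
(* box in column j that is the end of its row in the second diagram; the box   *)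
(* (i2, j) is the end of its row in the first diagram and is not in the second *)
(* one. The element e1 in position (r1, 1) gets the column label j.+1 and is   *)
(* appended to the row i2 of the first diagram.                                *)
Section TwoColumns.
Variables (n : nat) (u : seq nat) (h : nat -> nat) (bi bj : nat -> nat).
Variables (r1 i2 j : nat).
Hypothesis sum_u : sumn u = n.
Hypothesis nth_u : forall r, nth 0%N u r = ((r < h 0) + (r < h 1))%N.
Hypothesis le_h : (h 1 <= h 0)%N.
Hypothesis inj_b : forall r r', (r < h 0)%N -> (r' < h 0)%N ->
  bi r = bi r' -> bj r = bj r' -> r = r'.
Hypothesis down_bi : forall c r i, (c < 2)%N -> (r < h c)%N -> (i < bi r)%N ->
  exists r', [/\ (r' < h c)%N, bi r' = i & bj r' = bj r].
Hypothesis down_bj : forall c r k, (c < 2)%N -> (r < h c)%N -> (k < bj r)%N ->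
  exists r', [/\ (r' < h c)%N, bi r' = bi r & bj r' = k].
Hypothesis r1_lt : (r1 < h 1)%N.
Hypothesis bj_r1 : bj r1 = j.
Hypothesis out1 : forall r, (r < h 1)%N -> bi r = bi r1 -> bj r <> j.+1.
Hypothesis in2 : exists r, [/\ (r < h 0)%N, bi r = i2 & bj r = j].
Hypothesis out2 : forall r, (r < h 0)%N -> bi r = i2 -> bj r <> j.+1.
Hypothesis out2' : forall r, (r < h 1)%N -> bi r = i2 -> bj r <> j.

Local Notation row := (@row_of u n).
Local Notation c := (@col_of u n).
Implicit Types (e x : 'I_n) (p q th : 'S_n).

Let i0 e := bi (row e).
Let j0 e := bj (row e).

Lemma two_column_col_lt e : (c e < 2)%N.
Proof.
have := col_of_lt sum_u e; rewrite nth_u.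
by case: (_ < h 0)%N; case: (_ < h 1)%N => /= /leq_trans; apply.
Qed.

Lemma two_column_row_lt e : (row e < h (c e))%N.
Proof.
have := col_of_lt sum_u e; have := two_column_col_lt e; rewrite nth_u.
by case: (c e) => [|[|]] //= _; move: le_h; clear; lia.
Qed.

Lemma two_column_row_lt0 e : (row e < h 0)%N.
Proof.
have := two_column_row_lt e; have := two_column_col_lt e.
by case: (c e) => [|[|]] //= _ /leq_trans; apply.
Qed.

Lemma two_column_row_lt1 e : c e = 1%N -> (row e < h 1)%N.
Proof. by move=> ce; have := two_column_row_lt e; rewrite ce. Qed.

Lemma two_column_exists r k : (k < 2)%N -> (r < h k)%N -> exists e, row e = r /\ c e = k.
Proof.
move=> k2 lt_r; apply: (position_exists sum_u); rewrite nth_u.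
by case: k k2 lt_r => [|[|]] //= _; move: le_h; clear; lia.
Qed.

Lemma two_column_inj e e' : i0 e = i0 e' -> j0 e = j0 e' -> c e = c e' -> e = e'.
Proof.
move=> ie je ce; apply: (@row_col_inj u) => //.
exact: inj_b (two_column_row_lt0 e) (two_column_row_lt0 e') ie je.
Qed.

Variable e1 : 'I_n.
Hypotheses (row_e1 : row e1 = r1) (col_e1 : c e1 = 1%N).

Let j1 e := if e == e1 then j.+1 else j0 e.
(** Since [c e < 2], these numbers encode pairs. The columns of the tableau of shape [s] are the
    columns of the two diagrams; those of the tableau of shape [t] are their rows, after the move of
    [e1]. *)
Let cls1 e := (2 * j0 e + c e)%N.
Let cls2 e := if e == e1 then (2 * i2)%N else (2 * i0 e + c e)%N.

Lemma j0_e1 : j0 e1 = j. Proof. by rewrite /j0 row_e1. Qed.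

Lemma cls1E e e' : cls1 e = cls1 e' -> j0 e = j0 e' /\ c e = c e'.
Proof. rewrite /cls1; have := two_column_col_lt e; have := two_column_col_lt e'; clear; lia. Qed.

Lemma cls2E e e' : (2 * i0 e + c e = 2 * i0 e' + c e')%N -> i0 e = i0 e' /\ c e = c e'.
Proof. have := two_column_col_lt e; have := two_column_col_lt e'; clear; lia. Qed.

Lemma cls2_star e : e != e1 -> cls2 e = cls2 e1 -> i0 e = i2 /\ c e = 0%N.
Proof. rewrite /cls2 eqxx => /negPf->; have := two_column_col_lt e; clear; lia. Qed.

Lemma two_column_inj1 : injective_on_classes cls1 i0.
Proof. by move=> e e' /cls1E[je ce] ie; apply: two_column_inj. Qed.

Lemma two_column_down1 : down_closed cls1 i0.
Proof.
move=> e i lt_i.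
have [r' [lt_r' ir' jr']] := down_bi (two_column_col_lt e) (two_column_row_lt e) lt_i.
have [e' [re' ce']] := two_column_exists (two_column_col_lt e) lt_r'.
by exists e'; rewrite /cls1 /j0 /i0 re' ce' jr' ir'.
Qed.

Lemma two_column_inj2 : injective_on_classes cls2 j1.
Proof.
have star e : e != e1 -> cls2 e = cls2 e1 -> j1 e = j1 e1 -> e = e1.
  move=> ne /(cls2_star ne)[ie _]; rewrite /j1 (negPf ne) eqxx => je.
  by case: (out2 (two_column_row_lt0 e) ie).
move=> e e'; have [->|ne] := eqVneq e e1; have [->|ne'] := eqVneq e' e1 => //.
- by move=> ce je; apply/esym/star.
- exact: star.
rewrite /cls2 /j1 (negPf ne) (negPf ne') => /cls2E[ie ce] je; exact: two_column_inj.
Qed.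

Lemma two_column_down2 : down_closed cls2 j1.
Proof.
move=> e k; rewrite /j1; have [->|ne] := eqVneq e e1 => lt_k.
  have [r [lt_r ir jr]] := in2.
  have [r' [lt_r' ir' jr']] : exists r', [/\ (r' < h 0)%N, bi r' = i2 & bj r' = k].
    have [<-|nk] := eqVneq j k; first by exists r.
    have [|r' [? ? ?]] := @down_bj 0%N r k isT lt_r; first by rewrite jr; lia.
    by exists r'; split=> //; rewrite -ir.
  have [e' [re' ce']] := two_column_exists (k := 0) isT lt_r'.
  have ne : e' != e1 by apply/eqP => E; rewrite E col_e1 in ce'.
  by exists e'; rewrite /cls2 (negPf ne) eqxx /i0 /j0 re' ir' jr' ce' addn0.
have [r' [lt_r' ir' jr']] := down_bj (two_column_col_lt e) (two_column_row_lt e) lt_k.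
have [e' [re' ce']] := two_column_exists (two_column_col_lt e) lt_r'.
have ne' : e' != e1.
  (* If the element found were [e1], the row of the box [r1] in the second diagram would reach
     column [j.+1], against [out1]. *)
  apply/eqP => E; move: ce' re'; rewrite E col_e1 row_e1 => c1 r1E.
  have lt_row : (row e < h 1)%N by rewrite two_column_row_lt1.
  have lt_j : (j < j0 e)%N by rewrite -bj_r1 r1E jr'.
  have [r2 [lt2 ir2 jr2]] : exists r2, [/\ (r2 < h 1)%N, bi r2 = bi r1 & bj r2 = j.+1].
    have [E1|nj] := eqVneq (bj (row e)) j.+1; first by exists (row e); rewrite r1E ir'.
    have [|r2 [? ? ?]] := @down_bj 1%N (row e) j.+1 isT lt_row.
      by move: lt_j nj; rewrite /j0; lia.
    by exists r2; split=> //; rewrite r1E ir'.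
  exact: (out1 lt2 ir2 jr2).
by exists e'; rewrite /cls2 (negPf ne) (negPf ne') /i0 /j0 re' ir' jr' ce'.
Qed.

Lemma two_column_theta_star th : th \in fiber_stab cls2 -> th e1 = e1 ->
  (forall e, i0 (th e) = i0 e) /\ (forall e, c (th e) = c e).
Proof.
move=> /fiber_stabP thC th1.
have both e : i0 (th e) = i0 e /\ c (th e) = c e.
  have [->|ne] := eqVneq e e1; first by rewrite th1.
  have ne' : th e != e1 by rewrite -[X in _ != X]th1 (inj_eq perm_inj).
  by have := thC e; rewrite /cls2 (negPf ne) (negPf ne') => /cls2E.
by split=> e; have [] := both e.
Qed.

(* The condition under which q and k contribute to the value at                *)
(* (i0 \o p, j1 \o th \o p) of the function lowered_orbit defined below.       *)
Definition two_column_valid th p q (k : 'I_n) : bool :=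
  [&& c k == 1%N, j1 (th (p k)) == j.+1 &
    [forall x, (i0 (p x) == i0 (q x)) &&
       ((if x == k then j else j1 (th (p x))) == j0 (q x))]].

(* Up to a swap of two elements, p * th = q * rho where rho preserves the rows *)
(* of u, as p does. The signs of p and rho are given by the numbers of rows    *)
(* that they swap, which can be compared because q and th preserve columns;    *)
(* hence all the nonzero terms of the sum below have the same sign.            *)
Lemma two_column_valid_sign th p q k : th \in fiber_stab cls2 -> p \in row_stab u n ->
  q \in col_stab u n -> two_column_valid th p q k -> odd_perm th = odd_perm q.
Proof.
move=> thC pR qC /and3P[/eqP ck /eqP jk /forallP valid].
move: pR; rewrite row_stabE => /fiber_stabP rowp.
move: qC; rewrite col_stabE => /fiber_stabP colq.
have i0p x : i0 (p x) = i0 x by rewrite /i0 rowp.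
have i0q x : i0 (q x) = i0 x by have /andP[/eqP <- _] := valid x.
have j0qk : j0 (q k) = j by have /andP[_ /eqP] := valid k; rewrite eqxx.
have j0q x : x != k -> j0 (q x) = j1 (th (p x)).
  by move=> nk; have /andP[_ /eqP] := valid x; rewrite (negPf nk).
pose xs := p^-1%g (th^-1%g e1).
have mxs : th (p xs) = e1 by rewrite /xs !permKV.
(* Otherwise [q xs] would lie in row [i2], either in column [j.+1], against [out2], or in column [j]
   of the second diagram, against [out2']. *)
have th1 : th e1 = e1.
  apply/eqP/negPn/negP => ne; pose e' := th^-1%g e1.
  have ne' : e' != e1 by apply: contra ne => /eqP E; rewrite -{1}E /e' permKV.
  have /(cls2_star ne')[ie' _] : cls2 e' = cls2 e1.
    by move/fiber_stabP: thC => /(_ e') <-; rewrite /e' permKV.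
  have ixs : i0 (q xs) = i2 by rewrite i0q -i0p /xs permKV.
  have [E|nk] := eqVneq xs k.
    rewrite E in ixs; apply: (out2' (two_column_row_lt1 _) ixs j0qk).
    by rewrite colq.
  have := j0q _ nk; rewrite mxs /j1 eqxx; exact: out2 (two_column_row_lt0 _) ixs.
have [i0th colth] := two_column_theta_star thC th1.
pose m := (p * th)%g.
have mE x : m x = th (p x) by rewrite permM.
have i0m x : i0 (m x) = i0 x by rewrite mE i0th i0p.
(* If [m'] and [q] give the same labels, they differ by a permutation preserving the rows of [u],
   whose sign is given by [two_column_sign]. *)
have sign (m' : 'S_n) : (forall x, i0 (m' x) = i0 (q x)) -> (forall x, j0 (m' x) = j0 (q x)) ->
    odd_perm m' (+) odd_perm q =
    odd #|[set x | (c x == 0%N) && (c (m' x) == 1%N)]|.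
  move=> im' jm'; pose rho := (q^-1 * m')%g.
  have rhoE x : rho (q x) = m' x by rewrite permM permK.
  have row_rho x : row (rho x) = row x.
    rewrite -[x](permKV q) rhoE; apply: inj_b; rewrite ?two_column_row_lt0 //.
      exact: im'.
    exact: jm'.
  have <- : odd_perm rho = odd_perm m' (+) odd_perm q.
    by rewrite /rho odd_permM odd_permV addbC.
  rewrite (two_column_sign two_column_col_lt _ row_rho); last first.
    by move=> e e'; apply: row_col_inj.
  congr odd; rewrite -[RHS](card_imset _ (@perm_inj _ q)); apply: eq_card => x.
  rewrite inE; apply/andP/imsetP => [[cx crx]|[y + ->]].
    by exists (q^-1%g x); rewrite ?permKV // inE -rhoE permKV -colq permKV cx.
  by rewrite inE rhoE colq => /andP[].
have sign_p : odd_perm p = odd #|[set x | (c x == 0%N) && (c (m x) == 1%N)]|.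
  rewrite (two_column_sign two_column_col_lt _ rowp); last first.
    by move=> e e'; apply: row_col_inj.
  by congr odd; apply: eq_card => x; rewrite !inE mE colth.
have odd_m : odd_perm m = odd_perm p (+) odd_perm th by rewrite odd_permM.
have [xsk|nxsk] := eqVneq xs k.
  have := sign m; rewrite -sign_p odd_m => E.
  have {E} : odd_perm p (+) odd_perm th (+) odd_perm q = odd_perm p.
    apply: E => x; first by rewrite i0m i0q.
    have [->|nk] := eqVneq x k; first by rewrite -{1}xsk mE mxs j0_e1 j0qk.
    rewrite j0q // mE /j1; case: eqP => // E; case/eqP: nk.
    by rewrite -xsk; apply: (@perm_inj _ p); apply: (@perm_inj _ th); rewrite mxs.
  by case: (odd_perm p); case: (odd_perm th); case: (odd_perm q).
have mk1 : m k != e1.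
  by apply: contra nxsk => /eqP; rewrite mE -mxs => /perm_inj/perm_inj->.
have j0mk : j0 (m k) = j.+1 by move: jk; rewrite -mE /j1 (negPf mk1).
have ixs : i0 xs = bi r1 by rewrite -i0m mE mxs /i0 row_e1.
have cxs : c xs = 0%N.
  have := two_column_col_lt xs; case E: (c xs) => [|[|]] // _.
  have lt_row : (row (q xs) < h 1)%N by rewrite two_column_row_lt1 // colq.
  case: (out1 lt_row); first by rewrite -ixs -i0q.
  by have := j0q _ nxsk; rewrite mxs /j1 eqxx.
(* Both [m] and [q] preserve [i0], hence the sum of [j0] over each row of labels. In the row of [k]
   these sums would differ by 1 if [xs], which compensates the change at [k], were not in it. *)
have ik : i0 k = bi r1.
  apply/eqP/negPn/negP => nik.
  have sumE (g : 'S_n) : (forall x, i0 (g x) = i0 x) ->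
      (\sum_(x | i0 x == i0 k) j0 (g x) = \sum_(x | i0 x == i0 k) j0 x)%N.
    by move=> ig; rewrite [RHS](reindex_inj (@perm_inj _ g)); apply: eq_bigl => x; rewrite ig.
  have := etrans (sumE m i0m) (esym (sumE q i0q)).
  rewrite (bigD1 k) //= [RHS](bigD1 k) //= j0mk j0qk.
  rewrite (eq_bigr (fun x => j0 (q x))) => [/eqP|x /andP[/eqP ix nk]].
    by rewrite eqn_add2r eqn_leq ltnn.
  rewrite j0q // mE /j1; case: eqP => // E; case/eqP: nik.
  by rewrite -ix -i0m mE E /i0 row_e1.
have cmk : c (m k) = 0%N.
  have := two_column_col_lt (m k); case E: (c (m k)) => [|[|]] // _.
  case: (out1 (two_column_row_lt1 E)) => //.
  by rewrite -ik -i0m.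
(* After the swap of [xs] and [k] the labels are those of [q]. The swap changes the sign of [m] and
   removes exactly one element, [xs], from the set that is counted, so the two changes of sign
   cancel. *)
pose m' := (tperm xs k * m)%g.
have m'xs : m' xs = m k by rewrite permM tpermL.
have m'k : m' k = e1 by rewrite permM tpermR mE mxs.
have m'E x : x != xs -> x != k -> m' x = m x.
  by move=> n1 n2; rewrite permM tpermD // eq_sym.
have im' x : i0 (m' x) = i0 (q x).
  rewrite i0q permM i0m; case: tpermP => // ->; rewrite ?ixs ?ik //.
have jm' x : j0 (m' x) = j0 (q x).
  have [->|nk] := eqVneq x k; first by rewrite m'k j0_e1 j0qk.
  have [->|nxs] := eqVneq x xs.
    by rewrite m'xs j0mk j0q // mxs /j1 eqxx.
  rewrite m'E // j0q // mE /j1; case: eqP => // E; case/eqP: nxs.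
  by apply: (@perm_inj _ p); apply: (@perm_inj _ th); rewrite mxs.
have := sign m' im' jm'.
have setE : [set x | (c x == 0%N) && (c (m' x) == 1%N)] =
    [set x | (c x == 0%N) && (c (m x) == 1%N)] :\ xs.
  apply/setP => x; rewrite !inE.
  have [->|nxs] := eqVneq x xs; first by rewrite m'xs cmk andbF.
  have [->|nk] := eqVneq x k; first by rewrite ck.
  by rewrite m'E.
have := cardsD1 xs [set x | (c x == 0%N) && (c (m x) == 1%N)].
rewrite -setE inE cxs mE mxs col_e1 /= => cardE.
have : odd_perm p = ~~ odd #|[set x | (c x == 0%N) && (c (m' x) == 1%N)]|.
  by rewrite sign_p cardE.
rewrite odd_permM odd_tperm nxsk odd_m => -> /=.
by case: (odd _); case: (odd_perm th); case: (odd_perm q).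
Qed.

(** A label [j.+1] of [J] in the second column is lowered to [j] before [col_orbit] is applied, so
    the function lives on labellings whose content is that of [j0] with one [j] raised to [j.+1].
    Summing over [k] preserves the antisymmetry. *)
Definition lowered_orbit (I J : 'I_n -> nat) : algC :=
  \sum_(k | (c k == 1%N) && (J k == j.+1))
    col_orbit u i0 j0 I (fun x => if x == k then j else J x).

Lemma lowered_orbit_antisym : col_antisym u lowered_orbit.
Proof.
move=> q I J Cq; rewrite /lowered_orbit mulr_sumr [RHS](reindex_inj (@perm_inj _ q)) /=.
have colq x : c (q x) = c x by move: Cq; rewrite col_stabE => /fiber_stabP.
apply: eq_big => [k|k _]; first by rewrite colq.
rewrite -col_orbit_antisym //; congr col_orbit; apply: funext => x.
by rewrite (inj_eq perm_inj).
Qed.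

Lemma two_column_construct a b : (forall r, (r < h 0)%N -> bi r < a)%N ->
  (forall r, (r < h 0)%N -> bj r < b)%N -> (j.+1 < b)%N ->
  exists s t, [/\ [/\ is_partition s, is_partition t, (size s <= a)%N & (size t <= b)%N],
    forall i, nth 0%N s i = #|[set e | i0 e == i]|,
    forall k, nth 0%N t k = #|[set e | j1 e == k]|,
    sumn s = n & sumn t = n /\ kronecker s t u != 0%N].
Proof.
move=> lti ltj lt_j.
have lt1 e : (i0 e < a)%N by apply/lti/two_column_row_lt0.
have lt2 e : (j1 e < b)%N.
  by rewrite /j1; case: eqP => // _; apply/ltj/two_column_row_lt0.
have [s [g1 [part_s size_s sum_s nth_s frame1]]] :=
  frame_exists two_column_inj1 two_column_down1 lt1.
have [t [g2 [part_t size_t sum_t nth_t frame2]]] :=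
  frame_exists two_column_inj2 two_column_down2 lt2.
exists s, t; split=> //; split=> //.
apply: (kronecker_frames sum_s sum_t sum_u lowered_orbit_antisym _ frame1 frame2).
  move=> J g3; apply: (in_specht_ext (f := fun g =>
    \sum_(k | (c k == 1%N) && (J k == j.+1)) 1 *
    col_orbit u i0 j0 (pull s g g3) (fun x => if x == k then j else J x))).
    by move=> g; apply: eq_bigr => k _; rewrite mul1r.
  apply: in_specht_sum => k _; apply: (col_orbit_in_specht _ _ frame1) => //.
  - exact: two_column_inj1.
  - exact: two_column_down1.
  - exact: cls1E.
pose b0 th p q k := [forall x, (i0 (p x) == i0 (q x)) &&
       ((if x == k then j else j1 (th (p x))) == j0 (q x))].
have termE th p q k : th \in fiber_stab cls2 -> p \in row_stab u n ->
    q \in col_stab u n -> (c k == 1%N) && (j1 (th (p k)) == j.+1) ->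
    (-1) ^+ odd_perm th * ((-1) ^+ odd_perm q * (b0 th p q k)%:R) =
    (b0 th p q k)%:R :> algC.
  move=> thC pR qC /andP[ck jk]; apply: signr_mul_eq => valid.
  by apply: (two_column_valid_sign thC pR qC (k := k)); rewrite /two_column_valid ck jk.
have nneg3 th p k : th \in fiber_stab cls2 -> p \in row_stab u n ->
    (c k == 1%N) && (j1 (th (p k)) == j.+1) -> 0 <= (-1) ^+ odd_perm th *
    col_orbit u i0 j0 (fun x => i0 (p x)) (fun x => if x == k then j else j1 (th (p x))).
  move=> thC pR ck; rewrite /col_orbit mulr_sumr.
  by apply: sumr_ge0 => q qC; rewrite termE ?ler0n.
have nneg2 th p : th \in fiber_stab cls2 -> p \in row_stab u n ->
    0 <= (-1) ^+ odd_perm th * lowered_orbit (fun x => i0 (p x)) (fun x => j1 (th (p x))).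
  move=> thC pR; rewrite /lowered_orbit mulr_sumr.
  by apply: sumr_ge0 => k ck; apply: nneg3.
rewrite gt_eqF //; apply: (psumr_gt0_at (i0 := 1%g)); first exact: fiber_stab1.
  by move=> th thC; apply: sumr_ge0 => p pR; apply: nneg2.
apply: (psumr_gt0_at (i0 := 1%g)); first by rewrite row_stabE fiber_stab1.
  by move=> p pR; apply: nneg2; rewrite ?fiber_stab1.
rewrite /lowered_orbit mulr_sumr; apply: (psumr_gt0_at (i0 := e1)).
- by rewrite col_e1 !perm1 /j1 !eqxx.
- by move=> k ck; apply: nneg3; rewrite ?row_stabE ?fiber_stab1.
rewrite /col_orbit mulr_sumr; apply: (psumr_gt0_at (i0 := 1%g)).
- by rewrite col_stabE fiber_stab1.
- move=> q qC; rewrite termE ?ler0n ?row_stabE ?fiber_stab1 //.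
  by rewrite col_e1 !perm1 /j1 !eqxx.
rewrite termE ?col_stabE ?row_stabE ?fiber_stab1 //; last first.
  by rewrite col_e1 !perm1 /j1 !eqxx.
rewrite /b0; case: forallP => [_|[]]; first exact: ltr01.
move=> x; rewrite !perm1 eqxx /=; have [->|nx] := eqVneq x e1; first by rewrite j0_e1.
by rewrite /j1 (negPf nx).
Qed.

End TwoColumns.

(** The content of [t] is that of the second coordinates with one unit moved from [j] to [j.+1]; it
    is stated additively to avoid truncated subtraction. *)
Lemma kronecker_two_columns n a b u (h : nat -> nat) (bi bj : nat -> nat) (r1 i2 j : nat) :
  sumn u = n -> (forall r, nth 0%N u r = ((r < h 0) + (r < h 1))%N) -> (h 1 <= h 0)%N ->
  (forall r r', (r < h 0)%N -> (r' < h 0)%N -> bi r = bi r' -> bj r = bj r' -> r = r') ->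
  (forall c r i, (c < 2)%N -> (r < h c)%N -> (i < bi r)%N ->
     exists r', [/\ (r' < h c)%N, bi r' = i & bj r' = bj r]) ->
  (forall c r k, (c < 2)%N -> (r < h c)%N -> (k < bj r)%N ->
     exists r', [/\ (r' < h c)%N, bi r' = bi r & bj r' = k]) ->
  (r1 < h 1)%N -> bj r1 = j ->
  (forall r, (r < h 1)%N -> bi r = bi r1 -> bj r <> j.+1) ->
  (exists r, [/\ (r < h 0)%N, bi r = i2 & bj r = j]) ->
  (forall r, (r < h 0)%N -> bi r = i2 -> bj r <> j.+1) ->
  (forall r, (r < h 1)%N -> bi r = i2 -> bj r <> j) ->
  (forall r, (r < h 0)%N -> bi r < a)%N -> (forall r, (r < h 0)%N -> bj r < b)%N ->
  (j.+1 < b)%N ->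
  exists s t, [/\ [/\ is_partition s, is_partition t, (size s <= a)%N & (size t <= b)%N],
    forall i, nth 0%N s i = #|[set e : 'I_n | bi (row_of u e) == i]|,
    forall k, (nth 0%N t k + (k == j) =
      #|[set e : 'I_n | bj (row_of u e) == k]| + (k == j.+1))%N,
    sumn s = n & sumn t = n /\ kronecker s t u != 0%N].
Proof.
move=> sum_u nth_u le_h inj_b down_bi down_bj r1_lt bj_r1 out1 in2 out2 out2' lti ltj lt_j.
have [e1 [row_e1 col_e1]] := two_column_exists sum_u nth_u le_h (k := 1) isT r1_lt.
have [s [t [parts nth_s nth_t sum_s kron]]] := two_column_construct sum_u nth_u le_h inj_b down_bi
  down_bj r1_lt bj_r1 out1 in2 out2 out2' row_e1 col_e1 lti ltj lt_j.
exists s, t; split=> // k; rewrite nth_t.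
rewrite (cardsD1 e1) [in RHS](cardsD1 e1) !inE eqxx row_e1 bj_r1.
rewrite (eq_sym j) (eq_sym j.+1).
have -> : [set e | (if e == e1 then j.+1 else bj (row_of u e)) == k] :\ e1 =
    [set e | bj (row_of u e) == k] :\ e1.
  by apply/setP => e; rewrite !inE; case: eqP.
by move: (nat_of_bool _) (nat_of_bool _) #|_| => x y z; clear; lia.
Qed.

Lemma kronecker_swap (s t u : seq nat) : kronecker s t u != 0%N -> kronecker t s u != 0%N.
Proof.
move=> nz; have [tn un] : sumn t = sumn s /\ sumn u = sumn s.
  by move: nz; rewrite /kronecker; case: ifP => // /andP[/eqP-> /eqP->].
have /(kronecker_neq0P erefl tn un)[F [[Fs Ft Fu Finv] [g1 [g2 [g3 nzF]]]]] := nz.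
apply/(kronecker_neq0P tn erefl un); exists (fun x y z => F y x z).
by split; [split|exists g2, g1, g3].
Qed.

(* The box number r is (bi r, bj r). Rows and columns can be exchanged without *)
(* a cast, unlike for a function T : 'I_a -> 'I_b -> 'I_(a * b).               *)
Definition nat_tableau (a b N : nat) (num : nat -> nat -> nat) (bi bj : nat -> nat) : Prop :=
  [/\ forall i j, (i < a)%N -> (j < b)%N ->
        [/\ (num i j < N)%N, bi (num i j) = i & bj (num i j) = j],
      forall r, (r < N)%N -> [/\ (bi r < a)%N, (bj r < b)%N & num (bi r) (bj r) = r],
      forall i i' j, (i < i')%N -> (i' < a)%N -> (j < b)%N -> (num i j < num i' j)%N
    & forall i j j', (j < j')%N -> (j' < b)%N -> (i < a)%N -> (num i j < num i j')%N].

Lemma nat_tableau_swap a b N num bi bj : nat_tableau a b N num bi bj ->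
  nat_tableau b a N (fun j i => num i j) bj bi.
Proof.
move=> [H1 H2 H3 H4]; split.
- by move=> j i lj li; have [] := H1 _ _ li lj.
- by move=> r /H2[].
- by move=> j j' i lj lj' li; apply: H4.
- by move=> j i i' li li' lj; apply: H3.
Qed.

(** * Elements of [Kron] attached to a standard tableau *)

Section Generators.
Variables (a b N : nat) (num : nat -> nat -> nat) (bi bj : nat -> nat).
Hypothesis tab : nat_tableau a b N num bi bj.

Lemma Kron_single_column h (m : 'I_h -> nat) : (h <= N)%N ->
  injective m -> (forall e, m e < N)%N ->
  (forall e i, (i < bi (m e))%N -> exists e', m e' = num i (bj (m e))) ->
  (forall e j, (j < bj (m e))%N -> exists e', m e' = num (bi (m e)) j) ->
  exists s t, [/\ Kron a b N s t (nseq h 1%N),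
    forall i, nth 0%N s i = #|[set e | bi (m e) == i]|
  & forall j, nth 0%N t j = #|[set e | bj (m e) == j]|].
Proof.
have [H1 H2 _ _] := tab; move=> le_h inj_m lt_m down_i down_j.
have [||||| s [t [[p1 p2 z1 z2] nth_s nth_t sum_s [sum_t kron]]]] :=
  @kronecker_single_column a b h (fun e => bi (m e)) (fun e => bj (m e)).
- by move=> e; have [] := H2 _ (lt_m e).
- by move=> e; have [] := H2 _ (lt_m e).
- move=> e e' je ie; apply: inj_m.
  by have [_ _ <-] := H2 _ (lt_m e); have [_ _ <-] := H2 _ (lt_m e'); rewrite ie je.
- move=> e i lt_i; have [e' me'] := down_i _ _ lt_i; exists e'; rewrite me'.
  have [lt1 lt2 _] := H2 _ (lt_m e).
  by have [_ -> ->] := H1 _ _ (ltn_trans lt_i lt1) lt2.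
- move=> e j lt_j; have [e' me'] := down_j _ _ lt_j; exists e'; rewrite me'.
  have [lt1 lt2 _] := H2 _ (lt_m e).
  by have [_ -> ->] := H1 _ _ lt1 (ltn_trans lt_j lt2).
exists s, t; split=> //; split=> //; split=> //; last by rewrite size_nseq.
apply/andP; split; last by rewrite mem_nseq andbF.
apply/(sortedP 0%N) => i lt_i; rewrite size_nseq in lt_i; rewrite !nth_nseq.
by do 2!case: ifP => //; lia.
Qed.

Lemma Kron_two_columns j : (1 < a)%N -> (j.+1 < b)%N ->
  exists n s t u, [/\ Kron a b N s t u, sumn u = n,
    forall i, nth 0%N s i = #|[set e : 'I_n | bi (row_of u e) == i]|
  & forall k, (nth 0%N t k + (k == j) =
      #|[set e : 'I_n | bj (row_of u e) == k]| + (k == j.+1))%N].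
Proof.
have [H1 H2 H3 H4] := tab => lt_a lt_j.
have lt_j' := ltnW lt_j; have lt_a' := ltnW lt_a.
have [N0 bi0 bj0] := H1 0%N j lt_a' lt_j'.
have [N1 bi1 bj1] := H1 1%N j lt_a lt_j'.
(* The diagrams consist of the boxes numbered up to (1, j) and up to (0, j). Since [T] increases
   along rows, each ends its own row at column j, so the moved unit goes from the end of row 0 of
   the second diagram to the end of row 1 of the first. *)
pose h c := if c == 0%N then (num 1%N j).+1 else (num 0%N j).+1.
have lt01 : (num 0%N j < num 1%N j)%N by apply: H3.
have hN c : (h c <= N)%N by rewrite /h; case: eqP.
pose u := nseq (num 0%N j).+1 2%N ++ nseq (num 1%N j - num 0%N j) 1%N.
have nth_u r : nth 0%N u r = ((r < h 0%N) + (r < h 1%N))%N.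
  rewrite nth_cat !size_nseq !nth_nseq /h /=.
  case: (ltnP r (num 0%N j).+1) => lt_r; first by rewrite (leq_trans lt_r) ?leqW.
  rewrite addn0; case: ltnP => le_r; case: ltnP => le_r' //; move: lt01 le_r le_r' lt_r; clear; lia.
have part_u : is_partition u.
  apply/andP; split; last by rewrite mem_cat !mem_nseq /= !andbF.
  apply/(sortedP 0%N) => i _; rewrite !nth_u /=.
  by apply: leq_add; case: (ltnP i.+1) => // /ltnW->.
have [||||||||||||||| s [t [[p1 p2 z1 z2] nth_s nth_t sum_s [sum_t kron]]]] :=
  @kronecker_two_columns (sumn u) a b u h bi bj (num 0%N j) 1 j.
- by [].
- exact: nth_u.
- by rewrite /h /= ltnS ltnW.
- move=> r r' lt_r lt_r' ie je.
  have [_ _ <-] := H2 _ (leq_trans lt_r (hN _)).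
  by have [_ _ <-] := H2 _ (leq_trans lt_r' (hN _)); rewrite ie je.
- move=> c r i _ lt_r lt_i; have [l1 l2 rE] := H2 _ (leq_trans lt_r (hN _)).
  have [_ ib jb] := H1 _ _ (ltn_trans lt_i l1) l2.
  exists (num i (bj r)); split=> //; apply: ltn_trans lt_r.
  by rewrite -[X in (_ < X)%N]rE; apply: H3.
- move=> c r k _ lt_r lt_k; have [l1 l2 rE] := H2 _ (leq_trans lt_r (hN _)).
  have [_ ib jb] := H1 _ _ l1 (ltn_trans lt_k l2).
  exists (num (bi r) k); split=> //; apply: ltn_trans lt_r.
  by rewrite -[X in (_ < X)%N]rE; apply: H4.
- by [].
- by [].
- move=> r lt_r; rewrite bi0 => ir jr; have [_ _ rE] := H2 _ (leq_trans lt_r (hN 1%N)).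
  by move: lt_r; rewrite -rE ir jr /h /= ltnS leqNgt H4.
- by exists (num 1%N j).
- move=> r lt_r ir jr; have [_ _ rE] := H2 _ (leq_trans lt_r (hN 0%N)).
  by move: lt_r; rewrite -rE ir jr /h /= ltnS leqNgt H4.
- move=> r lt_r ir jr; have [_ _ rE] := H2 _ (leq_trans lt_r (hN 1%N)).
  by move: lt_r; rewrite -rE ir jr /h /= ltnS leqNgt H3.
- by move=> r lt_r; have [] := H2 _ (leq_trans lt_r (hN _)).
- by move=> r lt_r; have [] := H2 _ (leq_trans lt_r (hN _)).
- by [].
exists (sumn u), s, t, u; split=> //; split=> //; split=> //.
rewrite size_cat !size_nseq; have := hN 0%N; rewrite /h /=; lia.
Qed.

End Generators.

Lemma Kron_swap a b N s t u : Kron a b N s t u -> Kron b a N t s u.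
Proof. by move=> [[? ? ?] [? ? ?] /kronecker_swap ?]. Qed.

(** * The local cone at the minimal face *)

Section Basis.
Variables (R : realType) (a b : nat).

Lemma basis_eL (i k : 'I_a) : (basis_e i : 'rV[R]_(a + b)) 0 (lshift b k) = (i == k)%:R.
Proof. by rewrite row_mxEl mxE eqxx eq_sym. Qed.

Lemma basis_eR (i : 'I_a) (k : 'I_b) : (basis_e i : 'rV[R]_(a + b)) 0 (rshift a k) = 0.
Proof. by rewrite row_mxEr mxE. Qed.

Lemma basis_fL (j : 'I_b) (k : 'I_a) : (basis_f j : 'rV[R]_(a + b)) 0 (lshift b k) = 0.
Proof. by rewrite row_mxEl mxE. Qed.

Lemma basis_fR (j k : 'I_b) : (basis_f j : 'rV[R]_(a + b)) 0 (rshift a k) = (j == k)%:R.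
Proof. by rewrite row_mxEr mxE eqxx eq_sym. Qed.

Lemma eq_row_blocks (v w : 'rV[R]_(a + b)) :
  (forall k, v 0 (lshift b k) = w 0 (lshift b k)) ->
  (forall k, v 0 (rshift a k) = w 0 (rshift a k)) -> v = w.
Proof.
move=> El Er; apply/rowP => k; rewrite -(splitK k).
by case: (fintype.split k) => k' /=; rewrite ?El ?Er.
Qed.

Definition basisE := (basis_eL, basis_eR, basis_fL, basis_fR).

End Basis.

(** * The projection to the weight space and the steps *)

Section Cone.
Variables (R : realType) (a b : nat).
Hypotheses (a_gt0 : (0 < a)%N) (b_gt0 : (0 < b)%N).
Variable T : 'I_a -> 'I_b -> 'I_(a * b).
Hypothesis stdT : standard_tableau T.
Local Notation N := (a * b)%N.
Local Notation C := (PKron R a b N).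

Definition row_index (i : nat) : 'I_a := insubd (Ordinal a_gt0) i.
Definition col_index (j : nat) : 'I_b := insubd (Ordinal b_gt0) j.

Lemma tableau_box_exists : exists box : nat -> 'I_a * 'I_b,
  (forall i j, box (T i j) = (i, j)) /\
  (forall r, (r < N)%N -> T (box r).1 (box r).2 = r :> nat).
Proof.
have [[g gK Kg] _ _] := stdT.
have N_gt0 : (0 < N)%N by rewrite muln_gt0 a_gt0.
exists (fun r => g (insubd (Ordinal N_gt0) r)); split=> [i j|r lt_r].
  by rewrite valKd (gK (i, j)).
by rewrite Kg; apply: (insubdK (Ordinal N_gt0) lt_r).
Qed.

Variable box : nat -> 'I_a * 'I_b.
Hypothesis boxK : forall i j, box (T i j) = (i, j).
Hypothesis Kbox : forall r, (r < N)%N -> T (box r).1 (box r).2 = r :> nat.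

Let num i j : nat := T (row_index i) (col_index j).
Let bi r : nat := (box r).1.
Let bj r : nat := (box r).2.

Lemma val_row_index i : (i < a)%N -> row_index i = i :> nat.
Proof. by move=> lt_i; apply: (insubdK (Ordinal a_gt0) lt_i). Qed.

Lemma val_col_index j : (j < b)%N -> col_index j = j :> nat.
Proof. by move=> lt_j; apply: (insubdK (Ordinal b_gt0) lt_j). Qed.

Lemma row_indexK (i : 'I_a) : row_index i = i. Proof. exact: valKd. Qed.
Lemma col_indexK (j : 'I_b) : col_index j = j. Proof. exact: valKd. Qed.

Lemma tableau_nat : nat_tableau a b N num bi bj.
Proof.
have [_ rowT colT] := stdT; split.
- move=> i j lt_i lt_j; rewrite /num /bi /bj boxK /=.
  by split; rewrite ?val_row_index ?val_col_index ?ltn_ord.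
- by move=> r lt_r; rewrite /num /bi /bj row_indexK col_indexK Kbox.
- move=> i i' j lt_i lt_i' lt_j; apply: colT.
  by rewrite !val_row_index // (ltn_trans lt_i).
- move=> i j j' lt_j lt_j' lt_i; apply: rowT.
  by rewrite !val_col_index // (ltn_trans lt_j).
Qed.

Definition e_vec (i : nat) : 'rV[R]_(a + b) := basis_e (row_index i).
Definition f_vec (j : nat) : 'rV[R]_(a + b) := basis_f (col_index j).
Definition box_vec (r : nat) : 'rV[R]_(a + b) := basis_e (box r).1 + basis_f (box r).2.
Definition step_vec (s : nat) : 'rV[R]_(a + b) := box_vec s.+1 - box_vec s.

Lemma box_vecE r : box_vec r = e_vec (bi r) + f_vec (bj r).
Proof. by rewrite /e_vec /f_vec row_indexK col_indexK. Qed.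

(* The projection modulo the span of tableau_face T, which is its kernel.      *)
Definition to_weight (v : 'rV[R]_(a + b + N)) : 'rV[R]_(a + b) :=
  lsubmx v - row_mx (row_sums T (rsubmx v)) (col_sums T (rsubmx v)).

Lemma row_col_sumsE la :
  row_mx (row_sums T la) (col_sums T la) = \sum_(t : 'I_N) la 0 t *: box_vec t.
Proof.
have -> : \sum_(t : 'I_N) la 0 t *: box_vec t =
    \sum_i \sum_j la 0 (T i j) *: (basis_e i + basis_f j).
  have [bijT _ _] := stdT.
  rewrite pair_big (reindex (fun p : 'I_a * 'I_b => T p.1 p.2)) /=; last exact: onW_bij.
  by apply: eq_bigr => p _; rewrite /box_vec boxK.
apply: eq_row_blocks => k; rewrite ?row_mxEl ?row_mxEr summxE mxE.
  rewrite (bigD1 k) //= [X in _ = _ + X]big1 ?addr0 => [|i /negPf ni].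
    rewrite summxE; apply: eq_bigr => j _.
    by rewrite mxE [X in _ * X]mxE !basisE eqxx addr0 mulr1.
  by rewrite summxE big1 // => j _; rewrite mxE [X in _ * X]mxE !basisE ni addr0 mulr0.
apply: eq_bigr => i _; rewrite summxE (bigD1 k) //= big1 ?addr0 => [|j /negPf nj].
  by rewrite mxE [X in _ * X]mxE !basisE eqxx add0r mulr1.
by rewrite mxE [X in _ * X]mxE !basisE nj add0r mulr0.
Qed.

Lemma to_weightE v : to_weight v = lsubmx v - \sum_(t : 'I_N) (rsubmx v) 0 t *: box_vec t.
Proof. by rewrite /to_weight row_col_sumsE. Qed.

Lemma to_weight_is_linear : linear to_weight.
Proof.
move=> k v v'; rewrite !to_weightE !linearP /= scalerBr addrACA -opprD; congr (_ + - _).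
rewrite scaler_sumr -big_split; apply: eq_bigr => t _ /=.
by rewrite !mxE scalerDl scalerA.
Qed.

HB.instance Definition _ := GRing.isLinear.Build _ _ _ _ to_weight to_weight_is_linear.

Lemma sum_by_label n m (I : 'I_n -> nat) (cnt : nat -> nat) (V : lmodType R)
    (phi : nat -> V) :
  (forall e, I e < m)%N -> (forall i, #|[set e | I e == i]| = cnt i) ->
  \sum_(i < m) (cnt i)%:R *: phi i = \sum_(e : 'I_n) phi (I e).
Proof.
move=> lt_I cntE; rewrite [RHS](partition_big (fun e => Ordinal (lt_I e)) predT) //=.
apply: eq_bigr => i _; rewrite [RHS](eq_bigr (fun=> phi i)) => [|e /eqP <-] //.
rewrite sumr_const scaler_nat -cntE; congr (_ *+ _); apply: eq_card => e.
by rewrite !inE.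
Qed.

Lemma row_part_row s : row_mx (part_row R a s) 0 =
  \sum_(i < a) (nth 0%N s i)%:R *: e_vec i :> 'rV_(a + b).
Proof.
apply: eq_row_blocks => k; rewrite ?row_mxEl ?row_mxEr summxE mxE.
  rewrite (bigD1 k) //= big1 => [|i /negPf ni].
    by rewrite /e_vec row_indexK mxE basisE eqxx mulr1 addr0.
  by rewrite /e_vec row_indexK mxE basisE ni mulr0.
by rewrite big1 // => i _; rewrite mxE basisE mulr0.
Qed.

Lemma col_part_row t : row_mx 0 (part_row R b t) =
  \sum_(j < b) (nth 0%N t j)%:R *: f_vec j :> 'rV_(a + b).
Proof.
apply: eq_row_blocks => k; rewrite ?row_mxEl ?row_mxEr summxE mxE.
  by rewrite big1 // => i _; rewrite mxE basisE mulr0.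
rewrite (bigD1 k) //= big1 => [|i /negPf ni].
  by rewrite /f_vec col_indexK mxE basisE eqxx mulr1 addr0.
by rewrite /f_vec col_indexK mxE basisE ni mulr0.
Qed.

Definition kron_vec (s t u : seq nat) : 'rV[R]_(a + b + N) :=
  row_mx (row_mx (part_row R a s) (part_row R b t)) (part_row R N u).

Lemma to_weight_kron_vec n s t u : sumn u = n -> (size u <= N)%N ->
  to_weight (kron_vec s t u) =
  \sum_(i < a) (nth 0%N s i)%:R *: e_vec i + \sum_(j < b) (nth 0%N t j)%:R *: f_vec j
  - \sum_(e : 'I_n) box_vec (row_of u e).
Proof.
move=> sum_u size_u; rewrite to_weightE row_mxKl row_mxKr -row_part_row -col_part_row.
rewrite add_row_mx add0r addr0; congr (_ - _).
rewrite -(sum_by_label (m := N) (cnt := nth 0%N u) box_vec) => [|e|i].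
- by apply: eq_bigr => r _; rewrite mxE.
- exact: leq_trans (row_of_lt sum_u e) size_u.
- exact: card_row.
Qed.

Lemma kron_vec_in s t u : Kron a b N s t u -> C (kron_vec s t u).
Proof.
move=> K; exists 1%N, (fun=> 1), (fun=> kron_vec s t u); split=> [i|].
  by split; [exact: ler01|exists s, t, u].
by rewrite big_ord1 scale1r.
Qed.
Lemma box_vec_telescope r : (r < N)%N ->
  box_vec r = box_vec 0 + \sum_(s < N.-1) (s < r)%N%:R *: step_vec s.
Proof.
move=> lt_r.
have <- : \sum_(s < r) step_vec s = \sum_(s < N.-1) (s < r)%N%:R *: step_vec s.
  rewrite (big_ord_widen N.-1) => [|]; last by move: lt_r; clear; lia.
  by rewrite big_mkcond; apply: eq_bigr => s _; case: ifP; rewrite ?scale1r ?scale0r.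
by rewrite -(big_mkord predT step_vec) telescope_sumr // addrC subrK.
Qed.

(** The weight is the sum over the boxes [e] of [u] of [box_vec (m e) - box_vec (row_of u e)].
    Expanded along the steps, the coefficient of step r is the number of boxes of [u] in rows up to
    r minus the number of labels up to r. By [card_below_le] it is nonnegative, so the natural
    subtraction is exact. *)
Lemma kron_vec_weight s t u : Kron a b N s t u -> exists c : 'I_N.-1 -> nat,
  to_weight (kron_vec s t u) = \sum_(r < N.-1) (c r)%:R *: step_vec r.
Proof.
move=> [[part_s part_t part_u] [size_s size_t size_u] kron].
have [tn un] : sumn t = sumn s /\ sumn u = sumn s.
  by move: kron; rewrite /kronecker; case: ifP => // /andP[/eqP-> /eqP->].
have [I [J [cardI cardJ injIJ]]] := kronecker_labelling erefl tn un kron.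
set n := sumn s in tn un I J cardI cardJ injIJ.
have lt_label (K : 'I_n -> nat) r d : (forall i, #|[set e | K e == i]| = nth 0%N r i) ->
    (size r <= d)%N -> forall e, (K e < d)%N.
  move=> cardK size_r e; apply: leq_trans size_r; rewrite ltnNge; apply/negP => ge_r.
  have := cardK (K e); rewrite nth_default // => /eqP; rewrite cards_eq0 => /eqP E.
  by move/setP/(_ e): E; rewrite !inE eqxx.
have lt_I := lt_label _ _ _ cardI size_s; have lt_J := lt_label _ _ _ cardJ size_t.
have [num_lt box_num _ _] := tableau_nat.
pose m e := num (I e) (J e).
have lt_m e : (m e < N)%N by have [] := num_lt _ _ (lt_I e) (lt_J e).
have lt_row (e : 'I_n) : (row_of u e < N)%N := leq_trans (row_of_lt un e) size_u.
have inj_m : injective_on_classes (@col_of u n) m.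
  move=> e e' ce me; have [_ ie je] := num_lt _ _ (lt_I e) (lt_J e).
  have [_ ie' je'] := num_lt _ _ (lt_I e') (lt_J e').
  by apply: injIJ ce _ _; [rewrite -ie -ie' -/(m e) me|rewrite -je -je' -/(m e) me].
have le_card r : (#|[set e | m e < r]| <= #|[set e : 'I_n | row_of u e < r]|)%N.
  apply: (card_below_le _ inj_m); first exact: inj_row_col.
  exact: down_row_col.
exists (fun r => #|[set e : 'I_n | row_of u e < r.+1]| - #|[set e | m e < r.+1]|)%N.
rewrite (to_weight_kron_vec _ _ un size_u).
rewrite (sum_by_label e_vec lt_I cardI) (sum_by_label f_vec lt_J cardJ).
rewrite -big_split -sumrB /=.
rewrite (eq_bigr (fun e => \sum_(r < N.-1)
    ((r < m e)%N%:R - (r < row_of u e)%N%:R) *: step_vec r)) => [|e _].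
  rewrite exchange_big; apply: eq_bigr => r _ /=; rewrite -scaler_suml sumrB natrB //.
  congr (_ *: _); have count (K : 'I_n -> nat) :
      \sum_e (r < K e)%N%:R = n%:R - #|[set e | (K e < r.+1)%N]|%:R :> R.
    apply/eqP; rewrite eq_sym subr_eq -sum1dep_card natr_sum [X in _ + X]big_mkcond.
    rewrite -big_split (eq_bigr (fun=> 1)) => [|e _]; first by rewrite sumr_const card_ord.
    by rewrite ltnS /=; case: ltnP; rewrite ?addr0 ?add0r.
  by rewrite !count opprB addrC addrA subrK.
have -> : e_vec (I e) + f_vec (J e) = box_vec (m e).
  have [_ ie je] := num_lt _ _ (lt_I e) (lt_J e).
  by rewrite box_vecE -[X in e_vec X]ie -[X in f_vec X]je.
rewrite (box_vec_telescope (lt_m e)) (box_vec_telescope (lt_row e)).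
rewrite opprD addrACA subrr add0r -sumrB; apply: eq_bigr => r _.
by rewrite scalerBl.
Qed.

Lemma PKron_weight v : C v -> exists2 c : 'I_N.-1 -> R, forall r, 0 <= c r &
  to_weight v = \sum_(r < N.-1) c r *: step_vec r.
Proof.
move=> [m [k [w [kw ->]]]].
have /choice[c cE] : forall i, exists c : 'I_N.-1 -> nat,
    to_weight (w i) = \sum_(r < N.-1) (c r)%:R *: step_vec r.
  by move=> i; have [_ [s [t [u [K ->]]]]] := kw i; apply: kron_vec_weight.
exists (fun r => \sum_i k i * (c i r)%:R) => [r|].
  by apply: sumr_ge0 => i _; rewrite mulr_ge0 ?ler0n //; have [] := kw i.
rewrite linear_sum /=; under eq_bigr do rewrite linearZ /= cE scaler_sumr.
rewrite exchange_big; apply: eq_bigr => r _; rewrite scaler_suml.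
by apply: eq_bigr => i _; rewrite scalerA.
Qed.

(** * Realization of the steps in the cone *)

Lemma row_of_nseq1 h (e : 'I_h) : row_of (nseq h 1%N) e = e.
Proof.
have sum_h : sumn (nseq h 1%N) = h by rewrite sumn_nseq mul1n.
have col0 : col_of (nseq h 1%N) e = 0%N.
  by have := col_of_lt sum_h e; rewrite nth_nseq; case: ifP => // _; case: col_of.
have := row_of_lt sum_h e; rewrite size_nseq => lt_r.
have := reshape_indexK (nseq h 1%N) e.
rewrite -/(row_of (nseq h 1%N) e) -/(col_of (nseq h 1%N) e) col0 /flatten_index addn0.
by rewrite take_nseq ?sumn_nseq ?mul1n // ltnW.
Qed.

Lemma single_column_vec h (m : 'I_h -> nat) : (h <= N)%N ->
  injective m -> (forall e, m e < N)%N ->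
  (forall e i, (i < bi (m e))%N -> exists e', m e' = num i (bj (m e))) ->
  (forall e j, (j < bj (m e))%N -> exists e', m e' = num (bi (m e)) j) ->
  exists2 v, C v & rsubmx v = \row_t (t < h)%N%:R /\
    to_weight v = \sum_(e < h) box_vec (m e) - \sum_(e < h) box_vec e.
Proof.
move=> le_h inj_m lt_m down_i down_j.
have [s [t [K nth_s nth_t]]] := Kron_single_column tableau_nat le_h inj_m lt_m down_i down_j.
have [_ box_num _ _] := tableau_nat.
have sum_h : sumn (nseq h 1%N) = h by rewrite sumn_nseq mul1n.
exists (kron_vec s t (nseq h 1%N)); first exact: kron_vec_in.
split.
  by rewrite row_mxKr; apply/rowP => r; rewrite !mxE nth_nseq; case: ifP.
rewrite (to_weight_kron_vec _ _ sum_h) ?size_nseq //.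
have lt_i e : (bi (m e) < a)%N by have [] := box_num _ (lt_m e).
have lt_j e : (bj (m e) < b)%N by have [] := box_num _ (lt_m e).
rewrite (sum_by_label e_vec lt_i (fun i => esym (nth_s i))).
rewrite (sum_by_label f_vec lt_j (fun i => esym (nth_t i))).
rewrite -big_split /=; congr (_ - _); last by apply: eq_bigr => e _; rewrite row_of_nseq1.
by apply: eq_bigr => e _; rewrite box_vecE.
Qed.

(** The first h boxes of a standard tableau form a Young diagram. The resulting vectors span the
    kernel of [to_weight]. *)
Lemma initial_vec h : (h <= N)%N ->
  exists2 v, C v & rsubmx v = \row_t (t < h)%N%:R /\ to_weight v = 0.
Proof.
move=> le_h; have [num_lt box_num num_i num_j] := tableau_nat.
have lt_e (e : 'I_h) : (e < N)%N := leq_trans (ltn_ord e) le_h.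
have [|||||v Cv [v1 v2]] := @single_column_vec h (fun e => e : nat) => //.
- exact: val_inj.
- move=> e i lt_i; have [l1 l2 eE] := box_num _ (lt_e e).
  have lt_n : (num i (bj e) < h)%N.
    by apply: ltn_trans (ltn_ord e); rewrite -[X in (_ < X)%N]eE; apply: num_i.
  by exists (Ordinal lt_n).
- move=> e i lt_i; have [l1 l2 eE] := box_num _ (lt_e e).
  have lt_n : (num (bi e) i < h)%N.
    by apply: ltn_trans (ltn_ord e); rewrite -[X in (_ < X)%N]eE; apply: num_j.
  by exists (Ordinal lt_n).
by exists v => //; rewrite v1 v2 subrr.
Qed.
(** Excludes the rectangles with exactly one side equal to 1. There one of the three representations
    is trivial and the other two must be equal, so every vector of the cone has weight 0 and no step
    is realized. *)
Hypothesis nondeg : (a == 1%N) = (b == 1%N).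

(** In the triple of [Kron_two_columns], the contents of the boxes of [u] cancel in the weight and
    only the moved unit remains. *)
Lemma row_step_vec j : (1 < a)%N -> (j.+1 < b)%N ->
  exists2 v, C v & to_weight v = f_vec j.+1 - f_vec j.
Proof.
move=> lt_a lt_j; have [num_lt box_num _ _] := tableau_nat.
have [n [s [t [u [K sum_u nth_s nth_t]]]]] := Kron_two_columns tableau_nat lt_a lt_j.
exists (kron_vec s t u); first exact: kron_vec_in.
have [_ [_ _ size_u] _] := K.
have lt_row (e : 'I_n) : (row_of u e < N)%N := leq_trans (row_of_lt sum_u e) size_u.
have lt_i (e : 'I_n) : (bi (row_of u e) < a)%N by have [] := box_num _ (lt_row e).
have lt_k (e : 'I_n) : (bj (row_of u e) < b)%N by have [] := box_num _ (lt_row e).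
rewrite (to_weight_kron_vec _ _ sum_u size_u).
rewrite (sum_by_label e_vec lt_i (fun i => esym (nth_s i))).
have pick k0 : (k0 < b)%N -> \sum_(k < b) (k == k0 :> nat)%:R *: f_vec k = f_vec k0.
  move=> lt0; rewrite (bigD1 (Ordinal lt0)) //= eqxx scale1r big1 ?addr0 // => k.
  by rewrite -val_eqE /= => /negPf->; rewrite scale0r.
have -> : \sum_(k < b) (nth 0%N t k)%:R *: f_vec k =
    \sum_(e : 'I_n) f_vec (bj (row_of u e)) + (f_vec j.+1 - f_vec j).
  rewrite -(sum_by_label (m := b) f_vec lt_k (fun k => erefl _)).
  apply/eqP; rewrite addrA eq_sym subr_eq -(pick j.+1) // -(pick j) 1?ltnW //.
  rewrite -!big_split /=; apply/eqP/eq_bigr => k _.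
  by rewrite -!scalerDl -!natrD nth_t.
rewrite addrA -big_split /=.
rewrite (eq_bigr (fun e => box_vec (row_of u e))) => [|e _]; last by rewrite box_vecE.
by rewrite addrAC subrr add0r.
Qed.

Lemma col_step_vec i : (1 < b)%N -> (i.+1 < a)%N ->
  exists2 v, C v & to_weight v = e_vec i.+1 - e_vec i.
Proof.
move=> lt_b lt_i'; have [num_lt box_num _ _] := tableau_nat.
have [n [t [s [u [K sum_u nth_t nth_s]]]]] :=
  Kron_two_columns (nat_tableau_swap tableau_nat) lt_b lt_i'.
exists (kron_vec s t u); first exact/kron_vec_in/Kron_swap.
have [_ [_ _ size_u] _] := K.
have lt_row (e : 'I_n) : (row_of u e < N)%N := leq_trans (row_of_lt sum_u e) size_u.
have lt_i (e : 'I_n) : (bi (row_of u e) < a)%N by have [] := box_num _ (lt_row e).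
have lt_k (e : 'I_n) : (bj (row_of u e) < b)%N by have [] := box_num _ (lt_row e).
rewrite (to_weight_kron_vec _ _ sum_u size_u).
rewrite (sum_by_label f_vec lt_k (fun i => esym (nth_t i))).
have pick k0 : (k0 < a)%N -> \sum_(k < a) (k == k0 :> nat)%:R *: e_vec k = e_vec k0.
  move=> lt0; rewrite (bigD1 (Ordinal lt0)) //= eqxx scale1r big1 ?addr0 // => k.
  by rewrite -val_eqE /= => /negPf->; rewrite scale0r.
have -> : \sum_(k < a) (nth 0%N s k)%:R *: e_vec k =
    (e_vec i.+1 - e_vec i) + \sum_(e : 'I_n) e_vec (bi (row_of u e)).
  rewrite -(sum_by_label (m := a) e_vec lt_i (fun k => erefl _)).
  apply/eqP; rewrite addrC addrA eq_sym subr_eq -(pick i.+1) // -(pick i) 1?ltnW //.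
  rewrite -!big_split /=; apply/eqP/eq_bigr => k _.
  by rewrite -!scalerDl -!natrD nth_s.
rewrite -[X in X - _]addrA -big_split /=.
rewrite (eq_bigr (fun e => box_vec (row_of u e))) => [|e _]; last by rewrite box_vecE.
by rewrite addrK.
Qed.

Lemma num_box i j r : (i < a)%N -> (j < b)%N -> num i j = r -> bi r = i /\ bj r = j.
Proof.
have [num_lt _ _ _] := tableau_nat => lt_i lt_j <-.
by have [] := num_lt _ _ lt_i lt_j.
Qed.

Lemma step_vec_in s : (s.+1 < N)%N -> exists2 v, C v & to_weight v = step_vec s.
Proof.
move=> lt_s1; have lt_s := ltnW lt_s1.
have [num_lt box_num num_i num_j] := tableau_nat.
have [li lj numE] := box_num _ lt_s; have [lk ll numE'] := box_num _ lt_s1.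
move: li lj numE lk ll numE'; set i := bi s; set j := bj s; set k := bi s.+1; set l := bj s.+1.
move=> li lj numE lk ll numE'.
have stepE : step_vec s = e_vec k + f_vec l - (e_vec i + f_vec j).
  by rewrite /step_vec !box_vecE.
have num_le i' j' k' l' : (i' <= k')%N -> (j' <= l')%N -> (k' < a)%N -> (l' < b)%N ->
    (num i' j' <= num k' l')%N.
  move=> le1 le2 lt1 lt2; apply: (@leq_trans (num i' l')).
    move: le2; rewrite leq_eqVlt => /orP[/eqP->//|lt]; apply/ltnW/num_j => //.
    exact: leq_ltn_trans lt1.
  by move: le1; rewrite leq_eqVlt => /orP[/eqP->//|lt]; apply/ltnW/num_i.
have [Eik|nik] := eqVneq i k.
  have lt_jl : (j < l)%N.
    rewrite ltnNge; apply/negP => le_lj.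
    have := num_le k l k j (leqnn k) le_lj lk lj.
    by rewrite numE' -Eik numE ltnn.
  (* A box strictly between the two in the same row would carry a number strictly between [s] and
     [s.+1]. *)
  have El : l = j.+1.
    apply/eqP; rewrite eqn_leq lt_jl andbT leqNgt; apply/negP => lt_l.
    have lt1 := num_j i j j.+1 (ltnSn _) (ltn_trans lt_l ll) li.
    have lt2 := num_j i j.+1 l lt_l ll li.
    by move: lt1 lt2; rewrite numE Eik numE'; lia.
  have a_gt1 : (1 < a)%N.
    have : (1 < b)%N by move: lt_jl ll; clear; lia.
    by move=> b_gt1; rewrite ltn_neqAle a_gt0 andbT eq_sym nondeg gtn_eqF.
  have [|v Cv vE] := @row_step_vec j a_gt1; first by rewrite -El.
  by exists v => //; rewrite vE stepE Eik El opprD addrACA subrr add0r.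
have [Ejl|njl] := eqVneq j l.
  have lt_ik : (i < k)%N.
    rewrite ltnNge; apply/negP => le_ki.
    have := num_le k l i j le_ki; rewrite Ejl => /(_ (leqnn _) li ll).
    by rewrite numE' -Ejl numE ltnn.
  have Ek : k = i.+1.
    apply/eqP; rewrite eqn_leq lt_ik andbT leqNgt; apply/negP => lt_k.
    have lt1 := num_i i i.+1 j (ltnSn _) (ltn_trans lt_k lk) lj.
    have lt2 := num_i i.+1 k j lt_k lk lj.
    by move: lt1 lt2; rewrite numE Ejl numE'; lia.
  have b_gt1 : (1 < b)%N.
    have : (1 < a)%N by move: lt_ik lk; clear; lia.
    by move=> a_gt1; rewrite ltn_neqAle b_gt0 andbT eq_sym -nondeg gtn_eqF.
  have [|v Cv vE] := @col_step_vec i b_gt1; first by rewrite -Ek.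
  by exists v => //; rewrite vE stepE Ejl Ek opprD addrACA subrr addr0.
(* The first boxes, with the box [s] replaced by the box [s.+1]. They still form a Young diagram,
   because these two boxes share neither a row nor a column. *)
pose m (e : 'I_s.+1) := if (e : nat) == s then s.+1 else e.
have lt_m e : (m e < N)%N.
  by rewrite /m; case: eqP => // _; apply: leq_trans (ltn_ord e) lt_s.
have m_exists r : (r <= s.+1)%N -> r != s -> exists e, m e = r.
  move=> le_r nr; have [->|nr'] := eqVneq r s.+1.
    by exists ord_max; rewrite /m eqxx.
  have lt_r : (r < s.+1)%N by rewrite ltn_neqAle nr'.
  by exists (Ordinal lt_r); rewrite /m /= (negPf nr).
have m_le e : (m e <= s.+1)%N.
  by rewrite /m; case: eqP => // _; apply: ltnW.
have m_s1 e : m e = s.+1 \/ (m e < s)%N.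
  rewrite /m; case: eqP => [|/eqP ne]; [by left|right].
  by rewrite ltn_neqAle ne -ltnS ltn_ord.
have [|||||v Cv [_ vE]] := @single_column_vec s.+1 m => //.
- move=> e e'; rewrite /m => E; apply: val_inj; move: E; rewrite /=.
  have := ltn_ord e; have := ltn_ord e'.
  by case: eqP => [->|_]; case: eqP => [->|_]; lia.
- move=> e i' lt_i'; have [l1 l2 eE] := box_num _ (lt_m e).
  have lt_n : (num i' (bj (m e)) < m e)%N by rewrite -[X in (_ < X)%N]eE; apply: num_i.
  apply: m_exists; first exact: leq_trans (ltnW lt_n) (m_le e).
  apply/eqP => E; have [me|lt_e] := m_s1 e; last by move: lt_n lt_e; rewrite E; lia.
  have [_ jE] := num_box (ltn_trans lt_i' l1) l2 E.
  by case/eqP: njl; rewrite /j /l jE me.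
- move=> e j' lt_j'; have [l1 l2 eE] := box_num _ (lt_m e).
  have lt_n : (num (bi (m e)) j' < m e)%N by rewrite -[X in (_ < X)%N]eE; apply: num_j.
  apply: m_exists; first exact: leq_trans (ltnW lt_n) (m_le e).
  apply/eqP => E; have [me|lt_e] := m_s1 e; last by move: lt_n lt_e; rewrite E; lia.
  have [iE _] := num_box l1 (ltn_trans lt_j' l2) E.
  by case/eqP: nik; rewrite /i /k iE me.
exists v => //; rewrite vE !big_ord_recr /= /m eqxx opprD addrACA.
rewrite (eq_bigr (fun e : 'I_s => box_vec e)) => [|e _]; first by rewrite subrr add0r.
by rewrite /= ltn_eqF.
Qed.

(** * The minimal face and linear spans *)

Lemma PKron0 : C 0.
Proof.
exists 0%N, (fun=> 0), (fun=> 0); split=> [[]//|].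
by rewrite big_ord0.
Qed.

Lemma PKronD v w : C v -> C w -> C (v + w).
Proof.
move=> [m [k [f [kf ->]]]] [m' [k' [f' [kf' ->]]]].
exists (m + m')%N, (fun i => match fintype.split i with inl j => k j | inr j => k' j end),
  (fun i => match fintype.split i with inl j => f j | inr j => f' j end).
split=> [i|]; first by case: fintype.split.
rewrite big_split_ord; congr (_ + _); apply: eq_bigr => i _.
  by rewrite (unsplitK (inl i)).
by rewrite (unsplitK (inr i)).
Qed.

Lemma PKronZ k v : 0 <= k -> C v -> C (k *: v).
Proof.
move=> k0 [m [k' [f [kf ->]]]]; exists m, (fun i => k * k' i), f; split=> [i|].
  by have [ki fi] := kf i; rewrite mulr_ge0.
by rewrite scaler_sumr; apply: eq_bigr => i _; rewrite scalerA.
Qed.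

Lemma PKron_sum (I : Type) (r : seq I) (k : I -> R) (f : I -> 'rV[R]_(a + b + N)) :
  (forall i, 0 <= k i) -> (forall i, C (f i)) -> C (\sum_(i <- r) k i *: f i).
Proof.
move=> k0 Cf; elim/big_rec: _ => [|i v _ Cv]; first exact: PKron0.
by apply: PKronD => //; apply: PKronZ.
Qed.

Lemma to_weight_inj v w : to_weight v = to_weight w -> rsubmx v = rsubmx w -> v = w.
Proof.
rewrite /to_weight => + Er; rewrite Er => /addIr El.
by rewrite -[v]hsubmxK -[w]hsubmxK El Er.
Qed.

Lemma to_weight_row_mx w la :
  to_weight (row_mx w la) = w - row_mx (row_sums T la) (col_sums T la).
Proof. by rewrite /to_weight row_mxKl row_mxKr. Qed.

Lemma tableau_faceP v : tableau_face R T v <-> to_weight v = 0 /\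
  (forall s t : 'I_N, (s <= t)%N -> rsubmx v 0 t <= rsubmx v 0 s) /\
  (forall s, 0 <= rsubmx v 0 s).
Proof.
split=> [[la [dec pos ->]]|[v0 [dec pos]]].
  by rewrite to_weight_row_mx row_mxKr subrr.
exists (rsubmx v); split=> //; rewrite -[LHS]hsubmxK; congr row_mx.
by apply/eqP; rewrite -subr_eq0; apply/eqP.
Qed.

(** Abel summation: the coefficients are the successive differences of the third component, [insub]
    supplying the value 0 after the last entry. They are nonnegative exactly for nonincreasing,
    nonnegative sequences, and arbitrary ones give the whole kernel. *)
Lemma kernel_basis : exists V : 'I_N -> 'rV[R]_(a + b + N),
  [/\ forall h, C (V h), forall h, tableau_face R T (V h)
    & forall v, to_weight v = 0 -> v =
        \sum_(h < N) (rsubmx v 0 h - (if insub h.+1 is Some h' then rsubmx v 0 h' else 0)) *: V h].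
Proof.
have /choice[V VE] (h : 'I_N) : exists v,
    [/\ C v, rsubmx v = \row_t (t < h.+1)%N%:R & to_weight v = 0].
  by have [v Cv [v1 v2]] := initial_vec (ltn_ord h); exists v.
exists V; split=> [h|h|v v0]; first by have [] := VE h.
  have [_ V1 V0] := VE h; apply/tableau_faceP; rewrite V0 V1.
  split=> //; split=> [s t le_st|s]; rewrite !mxE ?ler0n // ler_nat.
  by case: (ltnP t h.+1) => // lt_t; rewrite (leq_ltn_trans le_st).
apply: to_weight_inj; rewrite linear_sum /=.
  by rewrite v0 big1 // => h _; rewrite linearZ /=; have [_ _ ->] := VE h; rewrite scaler0.
apply/rowP => t; rewrite summxE.
pose f r := if insub r is Some r' then rsubmx v 0 r' else 0.
have fE (r : 'I_N) : f r = rsubmx v 0 r by rewrite /f valK.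
have fN : f N = 0 by rewrite /f insubF // ltnn.
transitivity (\sum_(t <= r < N) (f r - f r.+1)).
  under eq_bigr do rewrite -[f _ - _]opprB.
  by rewrite sumrN telescope_sumr 1?ltnW // fN fE sub0r opprK.
rewrite big_geq_mkord big_mkcond; apply: eq_bigr => h _; have [_ V1 _] := VE h.
rewrite linearZ /= V1 [RHS]mxE [X in _ * X]mxE ltnS -fE -/(f h.+1).
by case: ifP; rewrite ?mulr1 ?mulr0.
Qed.

Lemma tableau_face_PKron v : tableau_face R T v -> C v.
Proof.
move=> /tableau_faceP[v0 [dec pos]]; have [V [CV _ VE]] := kernel_basis.
rewrite (VE v v0); apply: PKron_sum => // h; rewrite subr_ge0.
by case: insubP => //= h' _ hE; apply: dec; rewrite hE.
Qed.

Lemma ker_sub_span v (W : {vspace 'rV[R]_(a + b + N)}) :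
  (forall w, tableau_face R T w -> w \in W) -> to_weight v = 0 -> v \in W.
Proof.
move=> sW v0; have [V [_ FV VE]] := kernel_basis.
by rewrite (VE v v0) rpred_sum // => h _; apply/rpredZ/sW.
Qed.

Definition weight_map := linfun to_weight.

Lemma weight_mapE v : weight_map v = to_weight v. Proof. exact: lfunE. Qed.

(** A set containing the minimal face has a span containing the kernel of [to_weight], so the span
    is the preimage of that of the projected set. *)
Lemma linear_span_preim (S : set 'rV[R]_(a + b + N)) (W : {vspace 'rV[R]_(a + b)}) :
  (forall v, S v -> to_weight v \in W) -> (tableau_face R T `<=` S)%classic ->
  (forall V : {vspace 'rV[R]_(a + b)}, (forall v, S v -> to_weight v \in V) -> (W <= V)%VS) ->
  is_linear_span S (weight_map @^-1: W)%VS.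
Proof.
move=> SW fS Wmin; split=> [v /SW|V SV]; first by rewrite -memv_preim weight_mapE.
apply/subvP => v; rewrite -memv_preim weight_mapE => Wv.
have /subvP/(_ _ Wv)/memv_imgP[w Vw] : (W <= weight_map @: V)%VS.
  by apply: Wmin => w /SV Vw; rewrite -weight_mapE memv_img.
rewrite weight_mapE => E; rewrite -[v](subrK w) rpredD //.
apply: ker_sub_span => [u /fS /SV //|].
by rewrite linearB /= E subrr.
Qed.

Lemma linear_span_unique n (S : set 'rV[R]_n) (U V : {vspace 'rV[R]_n}) :
  is_linear_span S U -> is_linear_span S V -> U = V.
Proof.
by move=> [SU Umin] [SV Vmin]; apply/eqP; rewrite eqEsubv Umin ?Vmin.
Qed.

Lemma step_vec_img r : (r.+1 < N)%N -> step_vec r \in limg weight_map.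
Proof. by move=> /step_vec_in[v _ <-]; rewrite -weight_mapE memv_img ?memvf. Qed.

Lemma dim_preim (W : {vspace 'rV[R]_(a + b)}) : (W <= limg weight_map)%VS ->
  \dim (weight_map @^-1: W) = (\dim (lker weight_map) + \dim W)%N.
Proof.
move=> sW; rewrite -(limg_ker_dim weight_map (weight_map @^-1: W)) lpreimK //.
congr (\dim _ + _)%N; apply/capv_idPr/subvP => v.
by rewrite memv_ker -memv_preim => /eqP->; apply: mem0v.
Qed.

(** * Relaxations, their linear forms and their faces *)

Implicit Types (x : 'I_a -> R) (y : 'I_b -> R) (P : {set {set 'I_a * 'I_b}}).

Definition level x y (p : 'I_a * 'I_b) : R := x p.1 + y p.2.

Definition level_at x y r : R := level x y (box r).

Lemma level_atE x y i j : level_at x y (T i j) = x i + y j.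
Proof. by rewrite /level_at boxK. Qed.

Definition compatible x y : Prop :=
  forall r, (r.+1 < N)%N -> level_at x y r <= level_at x y r.+1.

Lemma compatible_le x y r r' : compatible x y -> (r <= r')%N -> (r' < N)%N ->
  level_at x y r <= level_at x y r'.
Proof.
move=> compat; elim: r' => [|r' IH]; first by rewrite leqn0 => /eqP->.
rewrite leq_eqVlt => /orP[/eqP-> //|]; rewrite ltnS => le_r lt_r'.
by apply: le_trans (compat _ lt_r'); apply: IH => //; apply: ltnW.
Qed.

Lemma compatibleP x y :
  compatible x y <-> relaxation_by T x y (preim_partition (level x y) [set: _]%SET).
Proof.
have [_ rowT colT] := stdT; split=> [compat|[_ _ xyT _] r lt_r].
  have le i j k l : (T i j < T k l)%N -> x i + y j <= x k + y l.
    by move=> /ltnW le_T; rewrite -!level_atE; apply: compatible_le.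
  split=> // [i k|j l]; rewrite leq_eqVlt => /orP[/eqP/ord_inj-> //|lt_i].
    by rewrite -(lerD2r (y (col_index 0))); apply/le/colT.
  by rewrite -(lerD2l (x (row_index 0))); apply/le/rowT.
by rewrite /level_at /level xyT // !Kbox // ltnW.
Qed.

Lemma relaxation_compatible x y P : relaxation_by T x y P ->
  compatible x y /\ P = preim_partition (level x y) [set: _]%SET.
Proof. by move=> rel; have [? ? ? ->] := rel; split=> //; apply/compatibleP; split. Qed.

Definition pairing x y (w : 'rV[R]_(a + b)) : R :=
  \sum_i x i * w 0 (lshift b i) + \sum_j y j * w 0 (rshift a j).

Lemma pairing_is_linear x y : linear (pairing x y : _ -> R^o).
Proof.
move=> k v w; rewrite /pairing scalerDr addrACA !scaler_sumr -!big_split /=.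
by congr (_ + _); apply: eq_bigr => i _; rewrite !mxE mulrDr mulrCA.
Qed.

HB.instance Definition _ x y :=
  GRing.isLinear.Build R _ R^o _ (pairing x y) (pairing_is_linear x y).

Lemma pairing_box x y r : pairing x y (box_vec r) = level_at x y r.
Proof.
rewrite /pairing /box_vec; congr (_ + _).
  rewrite (bigD1 (box r).1) //= big1 => [|i ni]; rewrite mxE !basisE !addr0.
    by rewrite eqxx mulr1.
  by rewrite eq_sym (negPf ni) mulr0.
rewrite (bigD1 (box r).2) //= big1 => [|i ni]; rewrite mxE !basisE add0r.
  by rewrite addr0 eqxx mulr1.
by rewrite eq_sym (negPf ni) mulr0.
Qed.

Lemma pairing_step x y r : pairing x y (step_vec r) = level_at x y r.+1 - level_at x y r.
Proof. by rewrite /step_vec linearB /= !pairing_box. Qed.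

Lemma relaxation_formE x y v : relaxation_form T x y v = pairing x y (to_weight v).
Proof.
rewrite to_weightE linearB linear_sum /=; congr (_ - _).
  by rewrite /pairing; congr (_ + _); apply: eq_bigr => i _; rewrite mxE.
have [bijT _ _] := stdT.
rewrite pair_big (reindex (fun p : 'I_a * 'I_b => T p.1 p.2)) /=; last exact: onW_bij.
by apply: eq_bigr => p _; rewrite linearZ /= pairing_box level_atE mulrC.
Qed.

Lemma relaxation_form_eq0 x y v : compatible x y -> C v ->
  relaxation_form T x y v = 0 <-> exists2 c : 'I_N.-1 -> R,
    forall r : 'I_N.-1, level_at x y r != level_at x y r.+1 -> c r = 0 &
    to_weight v = \sum_(r < N.-1) c r *: step_vec r.
Proof.
move=> compat Cv; rewrite relaxation_formE; split=> [|[c c0 ->]]; last first.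
  rewrite linear_sum big1 //= => r _; rewrite linearZ /= pairing_step.
  have [-> | /c0->] := eqVneq (level_at x y r) (level_at x y r.+1).
    by rewrite subrr scaler0.
  by rewrite scale0r.
have [c c_ge0 ->] := PKron_weight Cv; rewrite linear_sum /= => sum0.
exists c => // r ner; have lt_r (r' : 'I_N.-1) : (r'.+1 < N)%N.
  by have := ltn_ord r'; clear; lia.
have ge0 (r' : 'I_N.-1) : true -> 0 <= pairing x y (c r' *: step_vec r').
  by move=> _; rewrite linearZ /= pairing_step mulr_ge0 // subr_ge0 compat.
have := psumr_eq0P ge0 sum0 (i := r) isT; rewrite linearZ /= pairing_step => /eqP.
by rewrite mulf_eq0 subr_eq0 (eq_sym (level_at x y r.+1)) (negPf ner) orbF => /eqP.
Qed.

Lemma relaxation_form_ge0 x y v : compatible x y -> C v -> 0 <= relaxation_form T x y v.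
Proof.
move=> compat Cv; rewrite relaxation_formE; have [c c_ge0 ->] := PKron_weight Cv.
rewrite linear_sum; apply: sumr_ge0 => r _ /=; rewrite linearZ /= pairing_step.
by rewrite mulr_ge0 // subr_ge0 compat //; have := ltn_ord r; clear; lia.
Qed.

(** Levels increase weakly with the numbers of [T], so all the boxes numbered between two boxes of a
    region belong to it, and the steps joining them stay inside. *)
Lemma steps_sub x y (V : {vspace 'rV[R]_(a + b)}) p q : compatible x y ->
  (forall r, (r.+1 < N)%N -> level_at x y r = level_at x y r.+1 -> step_vec r \in V) ->
  level x y p = level x y q -> box_vec (T q.1 q.2) - box_vec (T p.1 p.2) \in V.
Proof.
move=> compat stepV.
wlog le_pq : p q / (T p.1 p.2 <= T q.1 q.2)%N => [wl E|].
  have [le|/ltnW le] := leqP (T p.1 p.2) (T q.1 q.2); first exact: wl.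
  by rewrite -opprB memvN; apply: wl.
rewrite -[level x y p]level_atE -[level x y q]level_atE.
move: (nat_of_ord (T p.1 p.2)) le_pq => r; have := ltn_ord (T q.1 q.2).
move: (nat_of_ord (T q.1 q.2)) => r'; elim: r' => [|r' IH] lt_r'.
  by rewrite leqn0 => /eqP->; rewrite subrr mem0v.
rewrite leq_eqVlt => /orP[/eqP-> _|]; first by rewrite subrr mem0v.
rewrite ltnS => le_r E.
have le1 := compatible_le compat le_r (ltnW lt_r').
have le2 := compat _ lt_r'.
have E1 : level_at x y r = level_at x y r'.
  by apply/eqP; rewrite eq_le le1 E le2.
rewrite -(subrK (box_vec r') (box_vec r'.+1)) -addrA rpredD //.
  by apply: stepV; rewrite // -E1.
by apply: IH => //; apply: ltnW.
Qed.

Lemma region_weights_sub x y (V : {vspace 'rV[R]_(a + b)}) : compatible x y ->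
  (region_weights (preim_partition (level x y) [set: _]%SET) <= V)%VS <->
  (forall r, (r.+1 < N)%N -> level_at x y r = level_at x y r.+1 -> step_vec r \in V).
Proof.
move=> compat; split=> [/subvP sV r lt_r E|stepV].
  apply: sV; rewrite /region_weights.
  pose A := [set q in [set: 'I_a * 'I_b]%SET | level x y (box r) == level x y q].
  have PA : A \in preim_partition (level x y) [set: _]%SET.
    by apply/imsetP; exists (box r); rewrite ?inE.
  apply: (subvP (sumv_sup A PA (subvv _))).
  apply: (subvP (sumv_sup (box r) _ (subvv _))); first by rewrite !inE /= eqxx.
  apply: (subvP (sumv_sup (box r.+1) _ (subvv _))).
    by rewrite !inE; apply/eqP.
  rewrite /step_vec /box_vec opprD addrACA addrA; exact: memv_line.
apply/subv_sumP => A /imsetP[p0 _ ->]; apply/subv_sumP => p pA.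
apply/subv_sumP => q qA; rewrite -memvE.
have Epq : level x y p = level x y q.
  by move: pA qA; rewrite !inE /= => /eqP<- /eqP.
have := steps_sub compat stepV Epq.
by rewrite /box_vec !boxK /= opprD addrACA addrA.
Qed.

Lemma step_vec_region x y r : (r.+1 < N)%N -> compatible x y ->
  level_at x y r = level_at x y r.+1 ->
  step_vec r \in region_weights (preim_partition (level x y) [set: _]%SET).
Proof.
move=> lt_r compat; have [sub _] := region_weights_sub
  (region_weights (preim_partition (level x y) [set: _]%SET)) compat.
by apply: sub.
Qed.

Lemma weight_space_sub (V : {vspace 'rV[R]_(a + b)}) :
  (weight_space <= V)%VS <-> (forall r, (r.+1 < N)%N -> step_vec r \in V).
Proof.
split=> [/subvP sV r lt_r|stepV].
  have -> : step_vec r = (basis_e (box r.+1).1 - basis_e (box r).1) +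
      (basis_f (box r.+1).2 - basis_f (box r).2).
    by rewrite /step_vec /box_vec opprD addrACA.
  apply: sV; apply: memv_add.
    apply: (subvP (sumv_sup (box r).1 isT (subvv _))).
    by apply: (subvP (sumv_sup (box r.+1).1 isT (subvv _))); apply: memv_line.
  apply: (subvP (sumv_sup (box r).2 isT (subvv _))).
  by apply: (subvP (sumv_sup (box r.+1).2 isT (subvv _))); apply: memv_line.
(* With zero sequences the whole rectangle is one region, so [steps_sub] joins any two boxes. *)
have compat0 : compatible (fun=> 0) (fun=> 0) by [].
have boxV p q : box_vec (T q.1 q.2) - box_vec (T p.1 p.2) \in V.
  by apply: (steps_sub compat0) => // r lt_r _; apply: stepV.
rewrite /weight_space subv_add; apply/andP; split.
  apply/subv_sumP => i _; apply/subv_sumP => k _; rewrite -memvE.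
  have := boxV (i, col_index 0) (k, col_index 0).
  by rewrite /box_vec !boxK /= opprD addrACA subrr addr0.
apply/subv_sumP => j _; apply/subv_sumP => l _; rewrite -memvE.
have := boxV (row_index 0, j) (row_index 0, l).
by rewrite /box_vec !boxK /= opprD addrACA subrr add0r.
Qed.

Lemma step_vec_weight r : (r.+1 < N)%N -> step_vec r \in (weight_space : {vspace 'rV[R]_(a + b)}).
Proof. by have [sub _] := weight_space_sub weight_space; apply: sub. Qed.

Lemma lt_pred (r : 'I_N.-1) : (r.+1 < N)%N.
Proof. by have := ltn_ord r; clear; lia. Qed.

Lemma PKron_span : is_linear_span C (weight_map @^-1: weight_space)%VS.
Proof.
apply: linear_span_preim => [v Cv|v /tableau_face_PKron //|V CV].
  have [c _ ->] := PKron_weight Cv; apply: rpred_sum => r _.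
  exact/rpredZ/step_vec_weight/lt_pred.
apply/weight_space_sub => r lt_r; have [v Cv <-] := step_vec_in lt_r.
exact: CV.
Qed.

Lemma relaxation_face_span x y : compatible x y ->
  is_linear_span (relaxation_face T x y)
    (weight_map @^-1: region_weights (preim_partition (level x y) [set: _]%SET))%VS.
Proof.
move=> compat; apply: linear_span_preim => [v [Cv]|v fv|V FV].
- move=> /(relaxation_form_eq0 compat Cv)[c c0 ->]; apply: rpred_sum => r _.
  have [E | /c0 ->] := eqVneq (level_at x y r) (level_at x y r.+1).
    exact/rpredZ/step_vec_region/E/compat/lt_pred.
  by rewrite scale0r mem0v.
- split; first exact: tableau_face_PKron.
  by have /tableau_faceP[v0 _] := fv; rewrite relaxation_formE v0 linear0.
apply/region_weights_sub => // r lt_r E; have [v Cv vE] := step_vec_in lt_r.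
by rewrite -vE; apply: FV; split=> //; rewrite relaxation_formE vE pairing_step E subrr.
Qed.

Lemma region_weights_le x y : compatible x y ->
  (region_weights (preim_partition (level x y) [set: _]%SET) <=
     (weight_space : {vspace 'rV[R]_(a + b)}))%VS.
Proof. by move=> compat; apply/region_weights_sub => // r lt_r _; apply: step_vec_weight. Qed.

Lemma weight_space_img : (weight_space <= limg weight_map)%VS.
Proof. by apply/weight_space_sub => r; apply: step_vec_img. Qed.

(** Both spans are preimages under [weight_map], so their dimensions exceed those of the weight
    subspaces by the same dimension of the kernel. *)
Lemma facet_dimP x y : compatible x y ->
  (exists U V, [/\ is_linear_span C U, is_linear_span (relaxation_face T x y) V
     & \dim U = (\dim V).+1]) <->
  \dim (weight_space : {vspace 'rV[R]_(a + b)}) =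
    (\dim (region_weights (preim_partition (level x y) [set: _]%SET) :
      {vspace 'rV[R]_(a + b)})).+1.
Proof.
move=> compat; have spanF := relaxation_face_span compat.
have dimC := dim_preim weight_space_img.
have dimF := dim_preim (subv_trans (region_weights_le compat) weight_space_img).
split=> [[U [V [spanU spanV dimE]]]|dimE]; last first.
  exists (weight_map @^-1: weight_space)%VS,
    (weight_map @^-1: region_weights (preim_partition (level x y) [set: _]%SET))%VS.
  by split=> //; [exact: PKron_span|rewrite dimC dimF dimE addnS].
move: dimE; rewrite (linear_span_unique spanU PKron_span).
by rewrite (linear_span_unique spanV spanF) dimC dimF -addnS => /addnI.
Qed.

(** * The facets containing the minimal face *)

Lemma maximal_facet x y : compatible x y ->
  maximal_relaxation R T (preim_partition (level x y) [set: _]%SET) <->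
  is_facet C (relaxation_face T x y).
Proof.
move=> compat; split=> [[_ [_ /(facet_dimP compat) dims]]|[_ /(facet_dimP compat) dims]].
  split=> //; exists (\col_k relaxation_form T x y (delta_mx 0 k)).
  have formE v : (v *m \col_k relaxation_form T x y (delta_mx 0 k)) 0 0 =
      relaxation_form T x y v.
    rewrite mxE relaxation_formE {2}[v]row_sum_delta !linear_sum.
    by apply: eq_bigr => k _; rewrite mxE relaxation_formE !linearZ.
  split=> [v Cv|]; first by rewrite formE relaxation_form_ge0.
  by apply/seteqP; split=> v [Cv E]; split; rewrite ?formE // -formE.
split; first by exists x, y; apply/compatibleP.
by split; first exact: region_weights_le.
Qed.

(** The form [l] vanishes on the kernel of [to_weight], so it is the pairing with its own first [a]
    and next [b] coordinates. Its values on the steps, all realized in the cone, are nonnegative,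
    which is compatibility. *)
Lemma facet_is_relaxation_face F : is_face C F -> (tableau_face R T `<=` F)%classic ->
  exists x y, compatible x y /\ F = relaxation_face T x y.
Proof.
move=> [l [l_ge0 ->]] fF.
pose x i := l (lshift N (lshift b i)) 0; pose y j := l (lshift N (rshift a j)) 0.
exists x, y.
have lE v : (v *m l) 0 0 = relaxation_form T x y v.
  rewrite relaxation_formE -{1}[v]hsubmxK.
  have -> : row_mx (lsubmx v) (rsubmx v) = row_mx (to_weight v) 0 +
      row_mx (row_mx (row_sums T (rsubmx v)) (col_sums T (rsubmx v))) (rsubmx v).
    by rewrite add_row_mx add0r /to_weight subrK.
  rewrite mulmxDl mxE [X in _ + X](_ : _ = 0) ?addr0; last first.
    pose f := linfun (mulmxr l : 'rV[R]_(a + b + N) -> 'rV[R]_1).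
    have fE w : f w = w *m l by rewrite lfunE.
    rewrite -fE.
    have : row_mx (row_mx (row_sums T (rsubmx v)) (col_sums T (rsubmx v))) (rsubmx v)
        \in lker f.
      apply: ker_sub_span => [w /fF[_ lw]|].
        by rewrite memv_ker fE; apply/eqP/rowP => k; rewrite ord1 lw mxE.
      by rewrite to_weight_row_mx subrr.
    by rewrite memv_ker => /eqP ->; rewrite mxE.
  rewrite mxE big_split_ord /= [X in _ + X]big1 ?addr0 => [|k _]; last first.
    by rewrite row_mxEr mxE mul0r.
  by rewrite big_split_ord /pairing; congr (_ + _); apply: eq_bigr => k _;
     rewrite row_mxEl mulrC.
split=> [r lt_r|].
  have [v Cv vE] := step_vec_in lt_r; have := l_ge0 v Cv.
  by rewrite lE relaxation_formE vE pairing_step subr_ge0.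
by apply/seteqP; split=> v [Cv E]; split; rewrite // -?lE // lE.
Qed.

Lemma level_preim x y x' y' :
  (forall p q, level x y p = level x y q <-> level x' y' p = level x' y' q) ->
  preim_partition (level x y) [set: _]%SET = preim_partition (level x' y') [set: _]%SET.
Proof.
move=> E; apply: eq_imset => p; apply/setP => q; rewrite !inE /=.
by apply/eqP/eqP => /E.
Qed.

Lemma preim_level x y x' y' p q :
  preim_partition (level x y) [set: _]%SET = preim_partition (level x' y') [set: _]%SET ->
  level x y p = level x y q -> level x' y' p = level x' y' q.
Proof.
move=> E Epq.
have : [set r in [set: 'I_a * 'I_b]%SET | level x y p == level x y r]
    \in preim_partition (level x' y') [set: _]%SET.
  by rewrite -E; apply/imsetP; exists p; rewrite ?inE.
case/imsetP => p0 _ /setP S; have := S p; have := S q.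
by rewrite !inE /= Epq !eqxx => /esym/eqP <- /esym/eqP <-.
Qed.

(** The boxes of a region are joined by steps inside it, so a pairing that vanishes on these steps
    is constant on the region. *)
Lemma level_steps x y x' y' p q : compatible x y ->
  (forall r, (r.+1 < N)%N -> level_at x y r = level_at x y r.+1 ->
     level_at x' y' r = level_at x' y' r.+1) ->
  level x y p = level x y q -> level x' y' p = level x' y' q.
Proof.
move=> compat step Epq.
pose f := linfun (pairing x' y' : 'rV[R]_(a + b) -> R^o).
have fE w : f w = pairing x' y' w by rewrite lfunE.
have : box_vec (T q.1 q.2) - box_vec (T p.1 p.2) \in lker f.
  apply: (steps_sub compat _ Epq) => r lt_r E.
  by rewrite memv_ker fE pairing_step (step r) // subrr.
rewrite memv_ker fE linearB /= !pairing_box subr_eq0 => /eqP.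
by rewrite !level_atE.
Qed.

Lemma facets_relaxations :
  exists F_ : {set {set 'I_a * 'I_b}} -> set 'rV[R]_(a + b + N),
    (forall P x y, maximal_relaxation R T P -> relaxation_by T x y P ->
       F_ P = relaxation_face T x y) /\
    set_bij [set P | maximal_relaxation R T P]%classic
            [set F | is_facet C F /\ (tableau_face R T `<=` F)%classic]%classic F_.
Proof.
(* The union over all the sequences inducing [P] avoids a choice; [F_E] shows that they all give the
   same face. *)
pose F_ P : set 'rV[R]_(a + b + N) :=
  [set v | exists x y, relaxation_by T x y P /\ relaxation_face T x y v]%classic.
have F_E P x y : relaxation_by T x y P -> F_ P = relaxation_face T x y.
  move=> rel; apply/seteqP; split=> [v [x' [y' [rel' [Cv]]]]|v Fv]; last by exists x, y.
  have [compat PE] := relaxation_compatible rel.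
  have [compat' PE'] := relaxation_compatible rel'.
  move=> /(relaxation_form_eq0 compat' Cv)[c c0 vE]; split=> //.
  apply/(relaxation_form_eq0 compat Cv); exists c => // r ner; apply: c0.
  apply: contra ner => /eqP E; apply/eqP.
  by apply: (preim_level (x := x') (y := y')) E; rewrite -PE -PE'.
have maxF P x y : relaxation_by T x y P ->
    maximal_relaxation R T P <-> is_facet C (relaxation_face T x y).
  by move=> /relaxation_compatible[compat ->]; apply: maximal_facet.
exists F_; split=> [P x y _|]; first exact: F_E.
split.
- move=> P /= maxP; have [[x [y rel]] _] := maxP.
  rewrite (F_E _ _ _ rel); split; first exact/(maxF _ _ _ rel).
  move=> v fv; split; first exact: tableau_face_PKron.
  by have /tableau_faceP[v0 _] := fv; rewrite relaxation_formE v0 linear0.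
- move=> P P'; rewrite !in_setE /= => -[[x [y rel]] _] [[x' [y' rel']] _].
  rewrite (F_E _ _ _ rel) (F_E _ _ _ rel') => eqF.
  have [compat ->] := relaxation_compatible rel.
  have [compat' ->] := relaxation_compatible rel'.
  (* A vector of the cone realizing a step lies in the face exactly when the step stays inside a
     region, so the face determines these steps. *)
  have step x1 y1 x2 y2 : relaxation_face T x1 y1 = relaxation_face T x2 y2 ->
      forall r, (r.+1 < N)%N -> level_at x1 y1 r = level_at x1 y1 r.+1 ->
      level_at x2 y2 r = level_at x2 y2 r.+1.
    move=> E r lt_r Er; have [v Cv vE] := step_vec_in lt_r.
    have : relaxation_face T x1 y1 v.
      by split; rewrite // relaxation_formE vE pairing_step Er subrr.
    rewrite E => -[_]; rewrite relaxation_formE vE pairing_step => /eqP.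
    by rewrite subr_eq0 => /eqP.
  by apply: level_preim => p q; split; apply: level_steps => //; apply: step.
- move=> F /= [facetF fF]; have [faceF _] := facetF.
  have [x [y [compat FE]]] := facet_is_relaxation_face faceF fF.
  have rel := (compatibleP x y).1 compat.
  exists (preim_partition (level x y) [set: _]%SET); last by rewrite (F_E _ _ _ rel).
  by apply/(maxF _ _ _ rel); rewrite -FE.
Qed.
End Cone.

Local Open Scope classical_set_scope.

Theorem proposition10 (R : realType) (a b : nat)
    (a_gt0 : (0 < a)%N) (b_gt0 : (0 < b)%N)
    (nondeg : (a == 1%N) = (b == 1%N))
    (T : 'I_a -> 'I_b -> 'I_(a * b))
    (stdT : standard_tableau T) (addT : additive_tableau R T) :
  exists F_ : {set {set 'I_a * 'I_b}} -> set 'rV[R]_(a + b + a * b),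
    (forall P (x : 'I_a -> R) (y : 'I_b -> R),
       maximal_relaxation R T P -> relaxation_by T x y P ->
       F_ P = relaxation_face T x y) /\
    set_bij [set P | maximal_relaxation R T P]
            [set F | is_facet (PKron R a b (a * b)) F /\ tableau_face R T `<=` F]
            F_.
Proof.
have [box [boxK Kbox]] := tableau_box_exists a_gt0 b_gt0 stdT.
exact: (facets_relaxations R a_gt0 b_gt0 stdT boxK Kbox nondeg).
Qed.
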